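(* Let $\varphi$ be an arbitrary linear fractional self-map of $\mathbb{D}$. (1) If $\varphi$ is trivial, neutral-elliptic, hyperbolic or parabolic, then $\varphi$ can always be embedded into a semigroup in $\mathbb{D}$. (2) If $\varphi$ is attractive-elliptic with Denjoy-Wolff point $\tau\in\mathbb{D}$ and repulsive fixed point $\beta\in\mathbb{C}_\infty\setminus\mathbb{D}$, let $\ell$ be the length of the canonical spiral associated to $\varphi'(\tau)\in\mathbb{D}\setminus\{0\}$. Then $\varphi$ can be embedded into a semigroup in $\mathbb{D}$ if and only if $$\left|\overline\tau-\frac1\beta\right|\ell\le|\varphi'(\tau)|\left|1-\frac\tau\beta\right|.$$
   Context: $\mathbb{D}$ is the open unit disc in $\mathbb{C}$, $\mathbb{C}_\infty$ is the Riemann sphere, and $\infty^{-1}$ means $0$. A linear fractional self-map of $\mathbb{D}$ is a non-constant map $z\mapsto\frac{az+b}{cz+d}$, with $|d|>|c|$, mapping $\mathbb{D}$ into $\mathbb{D}$. It is: trivial if it is the identity; neutral-elliptic if it is not the identity and there is $\tau\in\mathbb{D}$ with $\varphi(\tau)=\tau$, $|\varphi'(\tau)|=1$; attractive-elliptic if there is $\tau\in\mathbb{D}$ with $\varphi(\tau)=\tau$, $|\varphi'(\tau)|<1$; hyperbolic (resp. parabolic) if it is not the identity, has no fixed point in $\mathbb{D}$, and there is $\tau\in\partial\mathbb{D}$ with $\varphi(\tau)=\tau$ and $0<\varphi'(\tau)<1$ (resp. $\varphi'(\tau)=1$). In each non-trivial case $\tau$ is unique and is the Denjoy-Wolff point of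 $\varphi$. In the attractive-elliptic case the repulsive fixed point $\beta$ is the other fixed point of $\varphi$ as a Möbius transformation of $\mathbb{C}_\infty$. A (continuous) semigroup in $\mathbb{D}$ is a family $(\varphi_t)_{t\ge0}$ of holomorphic maps $\varphi_t:\mathbb{D}\to\mathbb{D}$ with $\varphi_0=\mathrm{id}$, $\varphi_{t+s}=\varphi_t\circ\varphi_s$, and $\varphi_t\to\mathrm{id}$ uniformly on compacta as $t\to0^+$; ''$\varphi$ can be embedded into $(\varphi_t)$'' means $\varphi_1=\varphi$. Canonical spiral: for $a\in\mathbb{D}\setminus\{0\}$ let $\lambda\in\mathbb{C}$ be the unique number with $\mathrm{Re}\,\lambda<0$, $\mathrm{Im}\,\lambda\in(-\pi,\pi]$ and $e^\lambda=a$. The canonical spiral associated to $a$ is the curve $\gamma_a:[1,\infty)\to\mathbb{D}$, $\gamma_a(t)=e^{\lambda t}$; its length is $\ell(\gamma_a)=\int_1^{+\infty}|\gamma_a'(t)|\,dt=\frac{|\lambda a|}{\mathrm{Re}(-\lambda)}$. *)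

(* Defs.v *)
From Stdlib Require Export Reals List.
From Coquelicot Require Export Coquelicot.
Open Scope C_scope.

Definition unit_disc (z : C) : Prop := (Cmod z < 1)%R.

(* Holomorphic self-maps of the disc are represented by total functions
   [C -> C]; their values outside the disc are irrelevant. *)
Definition maps_disc_into_disc (f : C -> C) : Prop :=
  forall z, unit_disc z -> unit_disc (f z).

Definition holomorphic_on_disc (f : C -> C) : Prop :=
  forall z, unit_disc z ->
    ex_derive (K := C_AbsRing) (V := C_NormedModule) f z.

Definition mobius (a b c d : C) (z : C) : C := (a * z + b) / (c * z + d).

(* Since |c| < |d|, the pole lies outside the closed disc, so that [mobius]
   and its derivative have their usual meaning on the boundary as well. *)
Definition linear_fractional_self_map (a b c d : C) : Prop :=
  (Cmod c < Cmod d)%R /\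
  (exists z w, unit_disc z /\ unit_disc w /\
     mobius a b c d z <> mobius a b c d w) /\
  maps_disc_into_disc (mobius a b c d).

(* The Riemann sphere; [None] is the point at infinity. *)
Definition sphere : Type := option C.

Definition mobius_sphere (a b c d : C) (w : sphere) : sphere :=
  match w with
  | None => if Ceq_dec c 0 then None else Some (a / c)
  | Some z => if Ceq_dec (c * z + d) 0 then None else Some (mobius a b c d z)
  end.

Definition sphere_inv (w : sphere) : C :=
  match w with
  | None => 0
  | Some z => / z
  end.

Definition trivial_map (f : C -> C) : Prop :=
  forall z, unit_disc z -> f z = z.

Definition neutral_elliptic (f : C -> C) : Prop :=
  ~ trivial_map f /\
  exists tau, unit_disc tau /\ f tau = tau /\ Cmod (C_derive f tau) = 1%R.

Definition no_fixed_point_in_disc (f : C -> C) : Prop :=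
  ~ exists z, unit_disc z /\ f z = z.

Definition hyperbolic (f : C -> C) : Prop :=
  ~ trivial_map f /\ no_fixed_point_in_disc f /\
  exists tau, Cmod tau = 1%R /\ f tau = tau /\
    exists r : R, (0 < r < 1)%R /\ C_derive f tau = RtoC r.

Definition parabolic (f : C -> C) : Prop :=
  ~ trivial_map f /\ no_fixed_point_in_disc f /\
  exists tau, Cmod tau = 1%R /\ f tau = tau /\ C_derive f tau = 1.

Definition attractive_elliptic_with_DW_point (f : C -> C) (tau : C) : Prop :=
  unit_disc tau /\ f tau = tau /\ (Cmod (C_derive f tau) < 1)%R.

(* The fixed point on the sphere other than the Denjoy-Wolff point [tau]. *)
Definition repulsive_fixed_point (a b c d tau : C) (beta : sphere) : Prop :=
  mobius_sphere a b c d beta = beta /\ beta <> Some tau.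

Definition compact_subset (K : C -> Prop) : Prop :=
  forall (I : Type) (U : I -> C -> Prop),
    (forall i, open (U i)) ->
    (forall z, K z -> exists i, U i z) ->
    exists l : list I, forall z, K z -> exists i, In i l /\ U i z.

(* Only the values [phi t z] with [0 <= t] and [z] in the disc matter. *)
Definition semigroup_in_disc (phi : R -> C -> C) : Prop :=
  (forall t, (0 <= t)%R ->
     maps_disc_into_disc (phi t) /\ holomorphic_on_disc (phi t)) /\
  (forall z, unit_disc z -> phi 0%R z = z) /\
  (forall t s z, (0 <= t)%R -> (0 <= s)%R -> unit_disc z ->
     phi (t + s)%R z = phi t (phi s z)) /\
  (forall K : C -> Prop,
     compact_subset K -> (forall z, K z -> unit_disc z) ->
     forall eps : R, (0 < eps)%R ->
     exists delta : R, (0 < delta)%R /\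
       forall t z, (0 < t < delta)%R -> K z -> (Cmod (phi t z - z) < eps)%R).

Definition embeddable (f : C -> C) : Prop :=
  exists phi : R -> C -> C,
    semigroup_in_disc phi /\ forall z, unit_disc z -> phi 1%R z = f z.

Definition Cexp (z : C) : C :=
  ((exp (Re z) * cos (Im z))%R, (exp (Re z) * sin (Im z))%R).

Definition canonical_exponent (a lambda : C) : Prop :=
  (Re lambda < 0)%R /\ (- PI < Im lambda <= PI)%R /\ Cexp lambda = a.

(* Defined by the same formula for all real t; only t >= 1 belongs to the
   spiral. *)
Definition canonical_spiral (lambda : C) (t : R) : C := Cexp (lambda * t).

Definition velocity (gamma : R -> C) (t : R) : C :=
  (Derive (fun s => Re (gamma s)) t, Derive (fun s => Im (gamma s)) t).

(* Length of the restriction of [gamma] to [1, +oo). *)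
Definition length_from_1 (gamma : R -> C) : R :=
  RInt_gen (fun t => Cmod (velocity gamma t))
    (at_point 1%R) (Rbar_locally p_infty).

(* Main.v *)
Require Import Defs.
From Stdlib Require Import Lra Lia Classical.

(** A linear fractional self-map [f] of the disc is understood in the coordinate
    that its fixed points make natural.

    Fixed point [tau] inside the disc.  Let [sigma] be the reciprocal of the
    other fixed point.  The coordinate [w = (z - tau) / (1 - sigma * z)] sends
    the two fixed points to [0] and infinity, so [f] becomes [w |-> m * w] with
    [m = f'(tau)], and the unit disc becomes the region
      [A |w|^2 + 2 Re (B * w) < C],
    where [A = 1 - |sigma|^2], [B = conj tau - sigma], [C = 1 - |tau|^2]
    ([disc_quad], [koenigs_mobius]).

    A holomorphic semigroup containing [f] consists of maps that commute with
    [f].  Such a map fixes [tau]; read in the coordinate [w] it commutes with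
    [w |-> m * w], and for [0 < |m| < 1] differentiability at [0] alone forces
    it to be [w |-> l * w], because its quotient by [w] is the same at all the
    points [m^n * w], which tend to [0] ([linear_of_homogeneous]).  The factors
    form a continuous one-parameter semigroup, hence equal [exp (mu * t)] with
    [exp mu = m] ([one_parameter_semigroup_spiral]).  So [f] embeds exactly when
    some spiral semigroup [exp (mu * t)] with [exp mu = m] leaves the region
    invariant ([embeddable_spiral], [elliptic_embedding]).

    For [Re mu < 0] invariance amounts to
      [|B|^2 (Im mu)^2 <= (Re mu)^2 A C].
    It says that the velocity [mu * w] nowhere points out of the region
    ([spiral_condition_necessary]); conversely it makes
    [exp (- Re mu * t) * (C - A |w|^2 - 2 Re (B * w))] nondecreasing along
    spirals ([spiral_invariance]).  Among the logarithms [mu] of [m] the one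
    with smallest [|Im mu|] is the canonical [lambda], so it gives the weakest
    condition ([Cexp_eq]).  The identity
    [|1 - tau * sigma|^2 = |B|^2 + A C] and the value
    [|lambda| |m| / (- Re lambda)] of the length of the canonical spiral turn it
    into the inequality to be proved ([spiral_condition_iff]).

    If [|m| = 1], the Schwarz lemma gives [sigma = conj tau], so [B = 0]; the
    region is a round disc centred at [0] and rotations preserve it
    ([neutral_elliptic_embeddable]).

    Fixed point [tau] on the boundary with derivative [r] in [(0, 1]].  The
    Cayley transform [(tau + z) / (tau - z)] sends [tau] to infinity and the disc
    to the right half-plane, where [f] is affine, [x |-> x / r + b], with
    [Re b >= 0] since [f] is a self-map.  Interpolating the affine map gives the
    semigroup ([boundary_fixed_point_embeddable]). *)

(** * Complex differentiability and linear fractional maps *)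

(** The abstract derivative tests points of the complex ball filter; all later
    estimates are carried out in this elementary form. *)
Lemma is_C_derive_iff (f : C -> C) (z l : C) :
  is_derive (K := C_AbsRing) (V := C_NormedModule) f z l <->
  forall eps : R, (0 < eps)%R -> exists delta : R, (0 < delta)%R /\
    forall y, (Cmod (y - z) < delta)%R ->
      (Cmod (f y - f z - (y - z) * l) <= eps * Cmod (y - z))%R.
Proof.
  split.
  - intros [_ H] eps Heps.
    destruct (H z (fun P HP => HP) (mkposreal eps Heps)) as [delta Hd].
    exists delta; split; [apply cond_pos|]. intros y Hy. exact (Hd y Hy).
  - intros H. split.
    + apply is_linear_scal_l.
    + intros x Hx.
      assert (E : z = x)
        by exact (is_filter_lim_locally_unique
                    (V := AbsRing_NormedModule C_AbsRing) z x Hx).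
      subst x. intros eps. destruct (H eps (cond_pos eps)) as [delta [Hd1 Hd2]].
      exists (mkposreal delta Hd1). intros y Hy. exact (Hd2 y Hy).
Qed.

Lemma mobius_sub (a b c d y z : C) :
  c * y + d <> 0 -> c * z + d <> 0 ->
  mobius a b c d y - mobius a b c d z
  = (a * d - b * c) * (y - z) / ((c * y + d) * (c * z + d)).
Proof. intros Hy Hz. unfold mobius. field. split; assumption. Qed.

Lemma Cmod_sub_ge (x y : C) : (Cmod x - Cmod y <= Cmod (x - y))%R.
Proof.
  assert (H := Cmod_triangle (x - y) y).
  replace (x - y + y) with x in H by ring. lra.
Qed.

Lemma Cmod_add_ge (x y : C) : (Cmod x - Cmod y <= Cmod (x + y))%R.
Proof.
  assert (H := Cmod_sub_ge x (- y)). rewrite Cmod_opp in H.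
  replace (x - - y) with (x + y) in H by ring. exact H.
Qed.

Lemma is_derive_mobius (a b c d z : C) :
  c * z + d <> 0 ->
  is_derive (K := C_AbsRing) (V := C_NormedModule) (mobius a b c d) z
    ((a * d - b * c) / ((c * z + d) * (c * z + d))).
Proof.
  intros Hz. apply is_C_derive_iff. intros eps Heps.
  set (D := a * d - b * c). set (K := c * z + d) in *.
  assert (HK : (0 < Cmod K)%R) by (apply Cmod_gt_0; exact Hz).
  assert (HD := Cmod_ge_0 D). assert (Hc := Cmod_ge_0 c).
  set (k := Cmod K) in *. set (g := Cmod c) in *. set (e := Cmod D) in *.
  (* within [d1] the denominator keeps half of its modulus; within [d2] the
     remainder [2 * e * g * r^2 / k^3] is at most [eps * r] *)
  set (d1 := (k / (2 * (g + 1)))%R).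
  set (d2 := (eps * (k * k * k) / (2 * (e * g + 1)))%R).
  assert (Hd1 : (0 < d1)%R) by (apply Rdiv_lt_0_compat; lra).
  assert (Heg : (0 <= e * g)%R) by (apply Rmult_le_pos; assumption).
  assert (Hk3 : (0 < k * k * k)%R) by (repeat apply Rmult_lt_0_compat; assumption).
  assert (Hd2 : (0 < d2)%R).
  { apply Rdiv_lt_0_compat; [apply Rmult_lt_0_compat; assumption | lra]. }
  exists (Rmin d1 d2). split. { apply Rmin_pos; assumption. }
  intros y Hy.
  assert (Hy1 := Rlt_le_trans _ _ _ Hy (Rmin_l d1 d2)).
  assert (Hy2 := Rlt_le_trans _ _ _ Hy (Rmin_r d1 d2)).
  set (r := Cmod (y - z)) in *.
  assert (Hr : (0 <= r)%R) by apply Cmod_ge_0.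
  assert (Hden : (k / 2 <= Cmod (c * y + d))%R).
  { assert (T := Cmod_add_ge K (c * (y - z))).
    replace (K + c * (y - z)) with (c * y + d) in T by (unfold K; ring).
    rewrite Cmod_mult in T. fold k g r in T.
    assert (g * r <= k / 2)%R; [|lra].
    assert (E : (k / 2 = (g + 1) * d1)%R) by (unfold d1; field; lra).
    rewrite E. apply Rmult_le_compat; lra. }
  assert (Hyd : c * y + d <> 0) by (apply Cmod_gt_0; lra).
  rewrite mobius_sub by assumption. fold D K.
  replace (D * (y - z) / ((c * y + d) * K) - (y - z) * (D / (K * K)))
    with (- (D * c * ((y - z) * (y - z))) / (K * K * (c * y + d)))
    by (unfold K; field; split; assumption).
  assert (Hnz : K * K * (c * y + d) <> 0).
  { apply Cmult_neq_0; [apply Cmult_neq_0|]; assumption. }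
  rewrite Cmod_div by exact Hnz. rewrite Cmod_opp, !Cmod_mult.
  fold e g r k.
  set (q := Cmod (c * y + d)) in *.
  apply Rle_div_l. { repeat apply Rmult_lt_0_compat; lra. }
  assert (E2 : (d2 * (2 * (e * g + 1)) = eps * (k * k * k))%R) by (unfold d2; field; lra).
  assert (Hq : (eps * (k * k * k) <= eps * (k * k * (2 * q)))%R).
  { apply Rmult_le_compat_l; [lra|]. apply Rmult_le_compat_l; [|lra].
    apply Rlt_le, Rmult_lt_0_compat; assumption. }
  assert (H1 : (e * g * r <= d2 * (e * g + 1))%R).
  { rewrite (Rmult_comm d2). apply Rmult_le_compat; lra. }
  replace (e * g * (r * r))%R with (r * (e * g * r))%R by ring.
  replace (eps * r * (k * k * q))%R with (r * (eps * (k * k * q)))%R by ring.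
  apply Rmult_le_compat_l; [assumption|]. lra.
Qed.

(** [C] is a normed module over itself in two ways that differ in the uniform
    structure only; derivatives depend on the norm and the multiplication, which
    agree, so the chain rule passes from one structure to the other. *)
Lemma is_C_derive_comp (f g : C -> C) (z l m : C) :
  is_derive (K := C_AbsRing) (V := C_NormedModule) g z m ->
  is_derive (K := C_AbsRing) (V := C_NormedModule) f (g z) l ->
  is_derive (K := C_AbsRing) (V := C_NormedModule) (fun w => f (g w)) z (m * l).
Proof.
  intros Hg Hf.
  assert (Hg' : is_derive (K := C_AbsRing)
                  (V := AbsRing_NormedModule C_AbsRing) g z m).
  { split; [apply is_linear_scal_l | exact (proj2 Hg)]. }
  exact (is_derive_comp f g z l m Hf Hg').
Qed.

(** * Spirals that preserve a disc or a half-plane *)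

Lemma nonneg_derive_le (g g' : R -> R) (t : R) :
  (0 <= t)%R ->
  (forall s, is_derive g s (g' s)) ->
  (forall s, (0 <= s)%R -> (0 <= g' s)%R) -> (g 0 <= g t)%R.
Proof.
  intros Ht Hd Hp.
  destruct (MVT_gen g 0 t g') as [s [Hs E]].
  - intros s _. apply Hd.
  - intros s _. apply continuity_pt_filterlim.
    apply (ex_derive_continuous (V := R_NormedModule) g s).
    exists (g' s). apply Hd.
  - rewrite Rmin_left, Rmax_right in Hs by lra.
    assert (0 <= g' s * (t - 0))%R by (apply Rmult_le_pos; [apply Hp|]; lra).
    lra.
Qed.

Lemma derive_nonpos_at_right_max (g : R -> R) (l : R) :
  is_derive g 0%R l -> (forall t, (0 <= t)%R -> (g t <= g 0)%R) -> (l <= 0)%R.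
Proof.
  intros Hd Hmax. apply Rnot_lt_le. intros Hl.
  apply is_derive_Reals in Hd.
  destruct (Hd (l / 2)%R) as [delta H]; [lra|].
  assert (Hp := cond_pos delta).
  specialize (H (delta / 2)%R). rewrite Rplus_0_l in H.
  assert (Hm := Hmax (delta / 2)%R).
  assert (H1 : (delta / 2 <> 0)%R) by lra.
  assert (H2 : (Rabs (delta / 2) < delta)%R) by (rewrite Rabs_right; lra).
  specialize (H H1 H2). apply Rabs_def2 in H. destruct H as [_ H].
  assert (((g (delta / 2) - g 0) / (delta / 2) <= 0)%R); [|lra].
  apply Rle_div_l; lra.
Qed.

Definition quad (A : R) (B w : C) : R := (A * Cmod w ^ 2 + 2 * Re (B * w))%R.

Lemma Cmod_sqr (z : C) : (Cmod z ^ 2 = fst z ^ 2 + snd z ^ 2)%R.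
Proof. apply Cmod2_alt. Qed.

(** With [z = (w + tau) / (1 + sigma * w)], the left-hand side is negative exactly
    when [z] lies in the unit disc.  So in the coordinate [w] the unit disc is a
    sublevel set of a polynomial with leading part a multiple of [|w|^2]: a disc or
    a half-plane, according to [|sigma| < 1] or [|sigma| = 1]. *)
Lemma disc_quad (sigma tau w : C) :
  (Cmod (w + tau) ^ 2 - Cmod (1 + sigma * w) ^ 2
   = quad (1 - Cmod sigma ^ 2) (Cconj tau - sigma) w - (1 - Cmod tau ^ 2))%R.
Proof.
  unfold quad. rewrite !Cmod_sqr.
  destruct sigma, tau, w. simpl. ring.
Qed.

Lemma quad_spiral (A : R) (B w mu : C) (t : R) :
  quad A B (Cexp (mu * t) * w)
  = (A * Cmod w ^ 2 * exp (2 * Re mu * t)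
     + 2 * exp (Re mu * t) * (Re (B * w) * cos (Im mu * t)
                              - Im (B * w) * sin (Im mu * t)))%R.
Proof.
  unfold quad.
  assert (E : (exp (2 * Re mu * t) = exp (Re mu * t) * exp (Re mu * t))%R).
  { rewrite <- exp_plus. f_equal. ring. }
  rewrite E, !Cmod_sqr. unfold Cexp.
  destruct mu as [m n], w as [x y], B as [b1 b2].
  replace (Re ((m, n) * t)) with (m * t)%R by (simpl; ring).
  replace (Im ((m, n) * t)) with (n * t)%R by (simpl; ring).
  assert (T := sin2_cos2 (n * t)). unfold Rsqr in T.
  simpl. set (e := exp (m * t)) in *. set (s := sin (n * t)) in *.
  set (k := cos (n * t)) in *.
  transitivity (A * (e * e * (s * s + k * k) * (x * x + y * y)) +
   2 * e * ((b1 * x - b2 * y) * k - (b1 * y + b2 * x) * s))%R; [ring|].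
  rewrite T. ring.
Qed.

(** The quantity bounded here is the imaginary part of [u * (c + i s)]. *)
Lemma Im_rotation_sqr_le (u : C) (c s : R) :
  (c * c + s * s = 1)%R ->
  ((Re u * s + Im u * c) ^ 2 <= Cmod u ^ 2)%R.
Proof.
  intros H. rewrite Cmod_sqr. destruct u as [x y]; simpl.
  assert (0 <= (x * c - y * s) ^ 2)%R by apply pow2_ge_0.
  replace ((x*(x*1) + y * (y*1)))%R with ((x*x+y*y)*(c*c+s*s))%R by (rewrite H; ring).
  nra.
Qed.

Lemma sum_nonneg_of_sqr_le_mult (X Y Z : R) :
  (0 <= X)%R -> (0 <= Y)%R -> (Z ^ 2 <= X * Y)%R -> (0 <= X + Y + 2 * Z)%R.
Proof.
  intros HX HY HZ. apply Rnot_lt_le. intros H.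
  assert (0 <= (X - Y) ^ 2)%R by apply pow2_ge_0. nra.
Qed.

(** The defect [q - quad A B w], multiplied by [exp (p * t)] with [p = - Re mu],
    is nondecreasing along the spiral.  Its derivative is
    [p * q * exp (p * t) + p * A * |w|^2 * exp (- p * t)] plus an oscillating term
    of size at most [2 * |Im mu| * |B| * |w|], and the hypothesis is exactly what the
    inequality between arithmetic and geometric means needs to absorb it. *)
Lemma spiral_invariance (A : R) (B : C) (q : R) (mu w : C) (t : R) :
  (0 <= A)%R -> (0 < q)%R -> (Re mu <= 0)%R ->
  (Cmod B ^ 2 * Im mu ^ 2 <= Re mu ^ 2 * (A * q))%R ->
  (quad A B w < q)%R -> (0 <= t)%R ->
  (quad A B (Cexp (mu * t) * w) < q)%R.
Proof.
  intros HA HC Hp Hcond Hw Ht. rewrite quad_spiral.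
  set (p := (- Re mu)%R). set (th := Im mu) in *.
  replace (Re mu) with (- p)%R in * by (unfold p; ring).
  set (x := Re (B * w)). set (y := Im (B * w)).
  set (W := (Cmod w ^ 2)%R).
  assert (HW : (0 <= W)%R) by apply pow2_ge_0.
  pose (G := fun t : R => (q * exp (p * t) - A * W * exp (- (p * t))
                - 2 * (x * cos (th * t) - y * sin (th * t)))%R).
  assert (HG : (G 0 <= G t)%R).
  { apply (nonneg_derive_le G
      (fun t => (p * q * exp (p * t) + p * (A * W) * exp (- (p * t))
                 + 2 * (th * (x * sin (th * t) + y * cos (th * t))))%R)).
    - exact Ht.
    - intros s. unfold G. auto_derive; [trivial|]. ring.
    - intros s Hs. apply sum_nonneg_of_sqr_le_mult.
      + apply Rmult_le_pos; [nra | apply Rlt_le, exp_pos].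
      + apply Rmult_le_pos; [|apply Rlt_le, exp_pos].
        assert (0 <= A * W)%R by (apply Rmult_le_pos; assumption). nra.
      + assert (E : (exp (p * s) * exp (- (p * s)) = 1)%R).
        { rewrite <- exp_plus, Rplus_opp_r. apply exp_0. }
        assert (Hv : ((x * sin (th * s) + y * cos (th * s)) ^ 2 <= Cmod B ^ 2 * W)%R).
        { unfold W. rewrite <- Rpow_mult_distr, <- Cmod_mult.
          apply Im_rotation_sqr_le. assert (T := sin2_cos2 (th * s)).
          unfold Rsqr in T. lra. }
        replace (p * q * exp (p * s) * (p * (A * W) * exp (- (p * s))))%R
          with ((- p) ^ 2 * (A * q) * W * (exp (p * s) * exp (- (p * s))))%R by ring.
        rewrite E, Rmult_1_r, Rpow_mult_distr.
        apply Rle_trans with (th ^ 2 * (Cmod B ^ 2 * W))%R.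
        * apply Rmult_le_compat_l; [apply pow2_ge_0 | exact Hv].
        * replace (th ^ 2 * (Cmod B ^ 2 * W))%R with (Cmod B ^ 2 * th ^ 2 * W)%R by ring.
          apply Rmult_le_compat_r; assumption. }
  assert (HG0 : (0 < G 0)%R).
  { unfold G. rewrite !Rmult_0_r, Ropp_0, exp_0, cos_0, sin_0.
    unfold quad in Hw. fold W x in Hw. lra. }
  assert (E1 : (exp (2 * - p * t) = exp (- (p * t)) * exp (- (p * t)))%R).
  { rewrite <- exp_plus. f_equal. ring. }
  assert (E2 : (exp (- p * t) = exp (- (p * t)))%R) by (f_equal; ring).
  assert (E3 : (exp (p * t) * exp (- (p * t)) = 1)%R).
  { rewrite <- exp_plus, Rplus_opp_r. apply exp_0. }
  rewrite E1, E2. unfold G in HG, HG0 |- *.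
  assert (He := exp_pos (- (p * t))).
  set (e := exp (- (p * t))) in *. set (e' := exp (p * t)) in *.
  set (v := (x * cos (th * t) - y * sin (th * t))%R) in *.
  assert (H : (0 < e * (q * e' - A * W * e - 2 * v))%R)
    by (apply Rmult_lt_0_compat; lra).
  replace (e * (q * e' - A * W * e - 2 * v))%R
    with (q * (e' * e) - (A * W * (e * e) + 2 * e * v))%R in H by ring.
  rewrite E3 in H. lra.
Qed.

(** At a boundary point the form cannot increase along an invariant spiral, so
    its derivative at time [0] is nonpositive.  The quadratic term of that
    derivative is eliminated with the equation of the boundary, which leaves a
    condition that is linear in [B * w]. *)
Lemma spiral_boundary_inequality (A : R) (B : C) (q : R) (mu w : C) :
  (0 <= A)%R -> (0 < q)%R ->
  (forall v t, (quad A B v < q)%R -> (0 <= t)%R ->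
     (quad A B (Cexp (mu * t) * v) < q)%R) ->
  quad A B w = q ->
  (Re mu * (2 * q - 2 * Re (B * w)) - 2 * (Im mu * Im (B * w)) <= 0)%R.
Proof.
  intros HA HC Hinv Hw.
  assert (HW : (0 <= A * Cmod w ^ 2)%R)
    by (apply Rmult_le_pos; [assumption | apply pow2_ge_0]).
  (* the region is star-shaped about [0], so [w] is a limit of inner points *)
  assert (Hin : forall s : R, (0 < s < 1)%R -> (quad A B (s * w) < q)%R).
  { intros s Hs.
    assert (E : quad A B (s * w) = (s * q - s * (1 - s) * (A * Cmod w ^ 2))%R).
    { rewrite <- Hw. unfold quad. rewrite !Cmod_sqr.
      destruct B, w; simpl; ring. }
    rewrite E.
    assert (0 <= s * (1 - s) * (A * Cmod w ^ 2))%R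
      by (apply Rmult_le_pos; [apply Rmult_le_pos; lra | assumption]).
    assert ((1 - s) * q > 0)%R by (apply Rmult_lt_0_compat; lra). lra. }
  pose (g := fun t : R => quad A B (Cexp (mu * t) * w)).
  assert (Hg0 : g 0%R = q).
  { unfold g. rewrite quad_spiral, !Rmult_0_r, exp_0, cos_0, sin_0.
    rewrite <- Hw. unfold quad. ring. }
  assert (Hmax : forall t, (0 <= t)%R -> (g t <= g 0)%R).
  { intros t Ht. rewrite Hg0. unfold g.
    set (v := Cexp (mu * t) * w).
    assert (Hs : forall s : R, (0 < s < 1)%R ->
              (s * s * (A * Cmod v ^ 2) + s * (2 * Re (B * v)) < q)%R).
    { intros s Hs. assert (T := Hinv _ t (Hin s Hs) Ht).
      replace (Cexp (mu * t) * (s * w)) with (s * v) in T by (unfold v; ring).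
      replace (quad A B (s * v)) with
        (s * s * (A * Cmod v ^ 2) + s * (2 * Re (B * v)))%R in T; [exact T|].
      unfold quad. rewrite !Cmod_sqr. destruct B, v; simpl; ring. }
    unfold quad. set (X := (A * Cmod v ^ 2)%R) in *. set (Y := (2 * Re (B * v))%R) in *.
    assert (HX : (0 <= X)%R)
      by (apply Rmult_le_pos; [assumption | apply pow2_ge_0]).
    apply Rnot_lt_le. intros Hlt.
    set (eta := (X + Y - q)%R).
    (* [1 - s] small enough that [s^2 X + s Y] stays above [q] *)
    set (D := (2 * X + Rabs Y + eta + 1)%R).
    assert (Heta : (0 < eta)%R) by (unfold eta; lra).
    assert (HaY := Rabs_pos Y). assert (HY := Rle_abs Y).
    assert (HD : (0 < D)%R) by (unfold D; lra).
    assert (H01 : (0 < eta / D < 1)%R).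
    { split; [apply Rdiv_lt_0_compat; assumption|].
      apply Rlt_div_l; unfold D; lra. }
    assert (T := Hs (1 - eta / D)%R). assert (T' := T ltac:(lra)). clear T.
    set (r := (eta / D)%R) in *.
    assert (Er : (r * D = eta)%R) by (unfold r; field; lra).
    assert (HrY : (r * Y <= r * Rabs Y)%R) by (apply Rmult_le_compat_l; lra).
    assert (0 <= r * r * X)%R by (apply Rmult_le_pos; [nra|assumption]).
    assert (0 < r * (eta + 1))%R by (apply Rmult_lt_0_compat; lra).
    unfold D in Er. unfold eta in *. nra. }
  assert (Hd : is_derive g 0%R
     (2 * Re mu * (A * Cmod w ^ 2) + 2 * (Re mu * Re (B * w) - Im mu * Im (B * w)))%R).
  { apply (is_derive_ext (fun t : R => (A * Cmod w ^ 2 * exp (2 * Re mu * t)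
     + 2 * exp (Re mu * t) * (Re (B * w) * cos (Im mu * t)
                              - Im (B * w) * sin (Im mu * t)))%R)).
    - intros t. unfold g. symmetry. apply quad_spiral.
    - auto_derive; [trivial|].
      rewrite !Rmult_0_r, exp_0, cos_0, sin_0. rewrite re_mult, im_mult. unfold Re, Im. ring. }
  assert (T := derive_nonpos_at_right_max g _ Hd Hmax).
  unfold quad in Hw. set (X := (A * Cmod w ^ 2)%R) in *.
  assert (EX : X = (q - 2 * Re (B * w))%R) by lra.
  rewrite EX in T. lra.
Qed.

(** The linear boundary condition is tested at the boundary point where it is
    most demanding. *)
Lemma spiral_condition_necessary (A : R) (B : C) (q : R) (mu : C) :
  (0 <= A)%R -> (0 < q)%R -> (Re mu < 0)%R ->
  (forall w t, (quad A B w < q)%R -> (0 <= t)%R ->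
     (quad A B (Cexp (mu * t) * w) < q)%R) ->
  (Cmod B ^ 2 * Im mu ^ 2 <= Re mu ^ 2 * (A * q))%R.
Proof.
  intros HA HC Hp Hinv.
  assert (HAC : (0 <= Re mu ^ 2 * (A * q))%R).
  { apply Rmult_le_pos; [apply pow2_ge_0 | apply Rmult_le_pos; lra]. }
  destruct (Ceq_dec B 0) as [HB | HB].
  { rewrite HB, Cmod_0. lra. }
  assert (Hb := proj1 (Cmod_gt_0 B) HB). set (b := Cmod B) in *.
  assert (Hbnd : forall u : C, (A * Cmod u ^ 2 + 2 * Re u * b ^ 2 = q * b ^ 2)%R ->
     (Re mu * (q - Re u) <= Im mu * Im u)%R).
  { intros u Hu.
    assert (E : B * (u / B) = u) by (field; assumption).
    assert (T := spiral_boundary_inequality A B q mu (u / B) HA HC Hinv).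
    rewrite E in T. assert (T' := fun H => T H). clear T.
    cut (quad A B (u / B) = q). { intros H; specialize (T' H); lra. }
    unfold quad. rewrite E, Cmod_div by assumption. fold b.
    apply (Rmult_eq_reg_r (b ^ 2)); [| apply pow_nonzero; lra].
    rewrite <- Hu. field. lra. }
  set (th := Im mu) in *. set (p := Re mu) in *.
  destruct (Req_dec A 0) as [HA0 | HA0].
  - (* half-plane: the boundary is a whole line, which only fits [Im mu = 0] *)
    destruct (Req_dec th 0) as [Hth | Hth]; [rewrite Hth; nra|].
    exfalso.
    assert (T := Hbnd ((q / 2)%R, (p * q / th)%R)).
    rewrite HA0 in T. simpl in T.
    assert (T' : (p * (q - q / 2) <= th * (p * q / th))%R) by (apply T; field).
    replace (th * (p * q / th))%R with (p * q)%R in T' by (field; assumption).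
    nra.
  - (* disc: [Hbnd] bounds the inner product of [- u] with [mu]; on the circle
       run through by [u], with centre [- b^2 / A], this is largest at the point
       seen from the centre in the direction of [- mu] *)
    assert (HA' : (0 < A)%R) by lra.
    assert (HD : (0 < b ^ 2 + A * q)%R) by nra.
    set (D := sqrt (b ^ 2 + A * q)).
    assert (HDp : (0 < D)%R) by (apply sqrt_lt_R0; assumption).
    assert (HDD : (D * D = b ^ 2 + A * q)%R) by (apply sqrt_sqrt; lra).
    set (m := sqrt (p ^ 2 + th ^ 2)).
    assert (Hmm : (m * m = p ^ 2 + th ^ 2)%R) by (apply sqrt_sqrt; nra).
    assert (Hm : (0 < m)%R) by (apply sqrt_lt_R0; nra).
    set (k := (D * b / (A * m))%R).
    assert (T := Hbnd ((- b ^ 2 / A - k * p)%R, (- k * th)%R)).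
    assert (T' : (p * (q - (- b ^ 2 / A - k * p)) <= th * (- k * th))%R).
    { apply T. rewrite Cmod_sqr. cbn [fst snd Re].
      assert (Ek : (k * k * (p ^ 2 + th ^ 2) = D * D * b ^ 2 / (A * A))%R).
      { rewrite <- Hmm. unfold k. field. lra. }
      transitivity (A * (k * k * (p ^ 2 + th ^ 2)) - b ^ 4 / A)%R; [field; lra|].
      rewrite Ek, HDD. field. lra. }
    clear T.
    (* multiplied by [A], the inequality reads [D * b * m <= - p * D^2] *)
    assert (T : (D * (b * m) <= D * (- p * D))%R).
    { assert (E : (A * k * (p ^ 2 + th ^ 2) = D * (b * m))%R).
      { rewrite <- Hmm. unfold k. field. lra. }
      rewrite <- E.
      replace (D * (- p * D))%R with (- p * (b ^ 2 + A * q))%R by (rewrite <- HDD; ring).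
      assert (T2 : (A * (p * (q - (- b ^ 2 / A - k * p))) <= A * (th * (- k * th)))%R)
        by (apply Rmult_le_compat_l; lra).
      replace (A * (p * (q - (- b ^ 2 / A - k * p))))%R
        with (p * (A * q + b ^ 2) + A * k * p ^ 2)%R in T2 by (field; lra).
      nra. }
    apply Rmult_le_reg_l in T; [|assumption].
    assert (Hbm : (0 <= b * m)%R) by (apply Rmult_le_pos; lra).
    assert (Hsq := Rmult_le_compat _ _ _ _ Hbm Hbm T T).
    replace (b * m * (b * m))%R with (b ^ 2 * (m * m))%R in Hsq by ring.
    replace (- p * D * (- p * D))%R with (p ^ 2 * (D * D))%R in Hsq by ring.
    rewrite Hmm, HDD in Hsq. lra.
Qed.

(** * One-parameter semigroups of complex numbers *)

Lemma is_derive_zero_const (g : R -> R) :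
  (forall s, is_derive g s 0%R) -> forall t, g t = g 0%R.
Proof.
  intros Hd t.
  destruct (MVT_gen g 0 t (fun _ => 0%R)) as [s [_ E]].
  - intros s _. apply Hd.
  - intros s _. apply continuity_pt_filterlim.
    apply (ex_derive_continuous (V := R_NormedModule) g s). exists 0%R. apply Hd.
  - lra.
Qed.

Lemma is_derive_RInt_from_0 (f : R -> R) :
  (forall t, continuous f t) -> forall t, is_derive (fun t => RInt f 0 t) t (f t).
Proof.
  intros Hf t. apply (is_derive_RInt (V := R_NormedModule) f _ 0%R).
  - exists (mkposreal 1 Rlt_0_1). intros s _.
    apply (RInt_correct (V := R_CompleteNormedModule)).
    apply (ex_RInt_continuous (V := R_CompleteNormedModule)). intros; apply Hf.
  - apply Hf.
Qed.

(** Integrating over a window shows that continuity implies differentiability: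
    with [F] and [H] primitives of [X] and [Y], the increments [F (t + d) - F t]
    and [H (t + d) - H t] are a fixed invertible linear image of [(X t, Y t)].
    The addition formulas then become a linear differential system. *)
Lemma addition_formulas_spiral (X Y : R -> R) :
  X 0%R = 1%R -> Y 0%R = 0%R ->
  (forall s t, X (s + t)%R = (X s * X t - Y s * Y t)%R) ->
  (forall s t, Y (s + t)%R = (X s * Y t + Y s * X t)%R) ->
  (forall t, continuous X t) -> (forall t, continuous Y t) ->
  exists p th : R, forall t,
    X t = (exp (p * t) * cos (th * t))%R /\ Y t = (exp (p * t) * sin (th * t))%R.
Proof.
  intros HX0 HY0 HXD HYD HXc HYc.
  pose (F := fun t => RInt X 0 t). pose (H := fun t => RInt Y 0 t).
  assert (HF : forall t, is_derive F t (X t)) by (apply is_derive_RInt_from_0, HXc).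
  assert (HH : forall t, is_derive H t (Y t)) by (apply is_derive_RInt_from_0, HYc).
  assert (EF : forall t, Derive F t = X t) by (intros; apply is_derive_unique, HF).
  assert (EH : forall t, Derive H t = Y t) by (intros; apply is_derive_unique, HH).
  assert (HF' : forall t, ex_derive F t) by (intros t; exists (X t); apply HF).
  assert (HH' : forall t, ex_derive H t) by (intros t; exists (Y t); apply HH).
  assert (F0 : F 0%R = 0%R) by apply (RInt_point (V := R_CompleteNormedModule)).
  assert (H0 : H 0%R = 0%R) by apply (RInt_point (V := R_CompleteNormedModule)).
  assert (WX : forall t s, (F (t + s) - F t = X t * F s - Y t * H s)%R).
  { intros t s.
    assert (T := is_derive_zero_const
      (fun s => F (t + s) - F t - (X t * F s - Y t * H s))%R).
    cbv beta in T. rewrite F0, H0, Rplus_0_r in T.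
    cut ((F (t + s) - F t - (X t * F s - Y t * H s))%R = 0%R); [lra|].
    rewrite T; [ring|]. intros r. auto_derive.
    - repeat split; auto.
    - rewrite !EF, EH, HXD. ring. }
  assert (WY : forall t s, (H (t + s) - H t = Y t * F s + X t * H s)%R).
  { intros t s.
    assert (T := is_derive_zero_const
      (fun s => H (t + s) - H t - (Y t * F s + X t * H s))%R).
    cbv beta in T. rewrite F0, H0, Rplus_0_r in T.
    cut ((H (t + s) - H t - (Y t * F s + X t * H s))%R = 0%R); [lra|].
    rewrite T; [ring|]. intros r. auto_derive.
    - repeat split; auto.
    - rewrite !EH, EF, HYD. ring. }
  assert (Hpos : exists d, (0 < F d)%R).
  { apply NNPP. intros Hn.
    assert (T : (1 <= 0)%R); [|lra].
    rewrite <- HX0 at 1. apply (derive_nonpos_at_right_max F _ (HF 0%R)).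
    intros t _. rewrite F0. apply Rnot_lt_le. intros Ht. apply Hn. exists t. exact Ht. }
  destruct Hpos as [d Hd]. set (P := F d) in *. set (Q := H d) in *.
  assert (HN : (0 < P * P + Q * Q)%R) by nra.
  assert (XE : forall t, (X t = (P * (F (t + d) - F t) + Q * (H (t + d) - H t))
                                 / (P * P + Q * Q))%R).
  { intros t. rewrite WX, WY. fold P Q. field. lra. }
  assert (YE : forall t, (Y t = (P * (H (t + d) - H t) - Q * (F (t + d) - F t))
                                 / (P * P + Q * Q))%R).
  { intros t. rewrite WX, WY. fold P Q. field. lra. }
  assert (DX : forall t, ex_derive X t).
  { intros t. apply (ex_derive_ext (fun t => ((P * (F (t + d) - F t) + Q * (H (t + d) - H t))
                                 / (P * P + Q * Q))%R)).
    - intros; symmetry; apply XE.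
    - auto_derive. repeat split; auto. }
  assert (DY : forall t, ex_derive Y t).
  { intros t. apply (ex_derive_ext (fun t => ((P * (H (t + d) - H t) - Q * (F (t + d) - F t))
                                 / (P * P + Q * Q))%R)).
    - intros; symmetry; apply YE.
    - auto_derive. repeat split; auto. }
  set (p := Derive X 0). set (th := Derive Y 0).
  assert (X' : forall t, is_derive X t (p * X t - th * Y t)%R).
  { intros t. apply (is_derive_ext (fun s => X t * X (s - t) - Y t * Y (s - t))%R).
    - intros s. rewrite <- HXD. f_equal. lra.
    - auto_derive; [repeat split; auto|].
      replace (t + - t)%R with 0%R by lra. change (Derive (fun x : R => X x) 0) with p.
      change (Derive (fun x : R => Y x) 0) with th. ring. }
  assert (Y' : forall t, is_derive Y t (th * X t + p * Y t)%R).
  { intros t. apply (is_derive_ext (fun s => X t * Y (s - t) + Y t * X (s - t))%R).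
    - intros s. rewrite <- HYD. f_equal. lra.
    - auto_derive; [repeat split; auto|].
      replace (t + - t)%R with 0%R by lra.
      change (Derive (fun x : R => X x) 0) with p.
      change (Derive (fun x : R => Y x) 0) with th. ring. }
  assert (DX' : forall t, Derive X t = (p * X t - th * Y t)%R)
    by (intros; apply is_derive_unique, X').
  assert (DY' : forall t, Derive Y t = (th * X t + p * Y t)%R)
    by (intros; apply is_derive_unique, Y').
  exists p, th. intros t.
  assert (C1 : (exp (- (p * t)) * (X t * cos (th * t) + Y t * sin (th * t)) = 1)%R).
  { rewrite (is_derive_zero_const
      (fun t => exp (- (p * t)) * (X t * cos (th * t) + Y t * sin (th * t)))%R).
    - rewrite !Rmult_0_r, Ropp_0, exp_0, cos_0, sin_0, HX0. ring.
    - intros s. auto_derive; [repeat split; auto|]. change (fun x : R => X x) with X. change (fun x : R => Y x) with Y.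
      rewrite DX', DY'. ring. }
  assert (C2 : (exp (- (p * t)) * (Y t * cos (th * t) - X t * sin (th * t)) = 0)%R).
  { rewrite (is_derive_zero_const
      (fun t => exp (- (p * t)) * (Y t * cos (th * t) - X t * sin (th * t)))%R).
    - rewrite !Rmult_0_r, Ropp_0, exp_0, cos_0, sin_0, HY0. ring.
    - intros s. auto_derive; [repeat split; auto|]. change (fun x : R => X x) with X. change (fun x : R => Y x) with Y.
      rewrite DX', DY'. ring. }
  assert (E3 : (exp (p * t) * exp (- (p * t)) = 1)%R).
  { rewrite <- exp_plus, Rplus_opp_r. apply exp_0. }
  assert (T := sin2_cos2 (th * t)). unfold Rsqr in T.
  set (e := exp (p * t)) in *. set (e' := exp (- (p * t))) in *.
  set (c := cos (th * t)) in *. set (s := sin (th * t)) in *.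
  split.
  - transitivity ((e * e') * (s * s + c * c) * X t)%R; [rewrite E3, T; ring|].
    transitivity (e * (c * (e' * (X t * c + Y t * s)) - s * (e' * (Y t * c - X t * s))))%R; [ring|].
    rewrite C1, C2. ring.
  - transitivity ((e * e') * (s * s + c * c) * Y t)%R; [rewrite E3, T; ring|].
    transitivity (e * (s * (e' * (X t * c + Y t * s)) + c * (e' * (Y t * c - X t * s))))%R; [ring|].
    rewrite C1, C2. ring.
Qed.

Lemma Rabs_Im_le_Cmod (z : C) : (Rabs (Im z) <= Cmod z)%R.
Proof. eapply Rle_trans; [apply Rmax_r | apply Rmax_Cmod]. Qed.

Lemma continuous_of_Cmod_bound (f : R -> R) (x K : R) (m : R -> C) :
  (0 < K)%R ->
  (forall eps, (0 < eps)%R -> exists delta, (0 < delta)%R /\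
     forall h, (Rabs h < delta)%R -> (Cmod (m h - 1) < eps)%R) ->
  (forall y, (Rabs (f y - f x) <= K * Cmod (m (y - x)%R - 1))%R) ->
  continuous f x.
Proof.
  intros HK Hm Hf. apply filterlim_locally. intros eps.
  destruct (Hm (eps / K)%R) as [delta [Hd1 Hd2]].
  { apply Rdiv_lt_0_compat; [apply cond_pos | assumption]. }
  exists (mkposreal delta Hd1). intros y Hy.
  change (Rabs (y - x) < delta)%R in Hy. change (Rabs (f y - f x) < eps)%R.
  apply Rle_lt_trans with (1 := Hf y).
  replace (pos eps) with (K * (eps / K))%R by (field; lra).
  apply Rmult_lt_compat_l; [assumption | apply Hd2, Hy].
Qed.

Lemma one_parameter_group_spiral (m : R -> C) :
  m 0%R = 1 ->
  (forall s t, m (s + t)%R = m s * m t) ->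
  (forall eps, (0 < eps)%R -> exists delta, (0 < delta)%R /\
     forall h, (Rabs h < delta)%R -> (Cmod (m h - 1) < eps)%R) ->
  exists mu : C, forall t : R, m t = Cexp (mu * t).
Proof.
  intros H0 HD Hc.
  assert (HB : forall x y, m y - m x = m x * (m (y - x)%R - 1)).
  { intros x y. replace y with (x + (y - x))%R at 1 by ring. rewrite HD. ring. }
  destruct (addition_formulas_spiral (fun t => Re (m t)) (fun t => Im (m t)))
    as [p [th Hpt]].
  - rewrite H0. reflexivity.
  - rewrite H0. reflexivity.
  - intros s t. rewrite HD. apply re_mult.
  - intros s t. rewrite HD. rewrite im_mult. ring.
  - intros t. apply (continuous_of_Cmod_bound _ t (Cmod (m t) + 1) m).
    + assert (T := Cmod_ge_0 (m t)). lra.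
    + exact Hc.
    + intros y. apply Rle_trans with (Cmod (m y - m t)).
      * apply (re_le_Cmod (m y - m t)).
      * rewrite HB, Cmod_mult. apply Rmult_le_compat_r; [apply Cmod_ge_0 | lra].
  - intros t. apply (continuous_of_Cmod_bound _ t (Cmod (m t) + 1) m).
    + assert (T := Cmod_ge_0 (m t)). lra.
    + exact Hc.
    + intros y. apply Rle_trans with (Cmod (m y - m t)).
      * apply (Rabs_Im_le_Cmod (m y - m t)).
      * rewrite HB, Cmod_mult. apply Rmult_le_compat_r; [apply Cmod_ge_0 | lra].
  - exists (p, th). intros t. destruct (Hpt t) as [E1 E2].
    unfold Cexp.
    replace (Re ((p, th) * t)) with (p * t)%R by (simpl; ring).
    replace (Im ((p, th) * t)) with (th * t)%R by (simpl; ring).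
    rewrite <- E1, <- E2. apply surjective_pairing.
Qed.

(** A semigroup of nonzero numbers extends to the group
    [m (max (t, 0)) / m (max (- t, 0))], to which the previous lemma applies. *)
Lemma one_parameter_semigroup_spiral (m : R -> C) :
  m 0%R = 1 -> m 1%R <> 0 ->
  (forall s t, (0 <= s)%R -> (0 <= t)%R -> m (s + t)%R = m s * m t) ->
  (forall eps, (0 < eps)%R -> exists delta, (0 < delta)%R /\
     forall h, (0 < h < delta)%R -> (Cmod (m h - 1) < eps)%R) ->
  exists mu : C, forall t : R, (0 <= t)%R -> m t = Cexp (mu * t).
Proof.
  intros H0 H1 HD Hc.
  assert (Hn : forall n t, (0 <= t <= INR n)%R -> m t <> 0).
  { induction n as [|n IH]; intros t Ht.
    - simpl in Ht. replace t with 0%R by lra. rewrite H0.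
      exact C1_nz.
    - rewrite S_INR in Ht. destruct (Rle_dec t 1) as [Hle | Hgt].
      + intros E. apply H1. replace 1%R with (t + (1 - t))%R by ring.
        rewrite HD, E by lra. ring.
      + replace t with ((t - 1) + 1)%R by ring. rewrite HD by lra.
        apply Cmult_neq_0; [apply IH; lra | exact H1]. }
  assert (Hnz : forall t, (0 <= t)%R -> m t <> 0).
  { intros t Ht. destruct (nfloor_ex t Ht) as [n [_ Hn']].
    apply (Hn (S n)). rewrite S_INR. lra. }
  (* the group generated by the semigroup *)
  pose (M := fun t => m (Rmax t 0) / m (Rmax (- t) 0)).
  assert (HM : forall t, (0 <= t)%R -> M t = m t).
  { intros t Ht. unfold M. rewrite Rmax_left, Rmax_right, H0 by lra. field. }
  assert (HMn : forall t, (t < 0)%R -> M t = / m (- t)%R).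
  { intros t Ht. unfold M. rewrite Rmax_right, Rmax_left, H0 by lra.
    unfold Cdiv. ring. }
  destruct (one_parameter_group_spiral M) as [mu Hmu].
  - rewrite HM by lra. exact H0.
  - intros s t. unfold M.
    assert (Hp := fun x => Rmax_r x 0).
    assert (E : m (Rmax (s + t) 0) * (m (Rmax (- s) 0) * m (Rmax (- t) 0))
                = m (Rmax s 0) * m (Rmax t 0) * m (Rmax (- (s + t)) 0)).
    { rewrite <- !HD; try apply Hp; try (apply Rplus_le_le_0_compat; apply Hp).
      f_equal. unfold Rmax. repeat destruct Rle_dec; lra. }
    assert (N1 := Hnz _ (Hp (- s)%R)). assert (N2 := Hnz _ (Hp (- t)%R)).
    assert (N3 := Hnz _ (Hp (- (s + t))%R)).
    set (x1 := m (Rmax (- s) 0)) in *. set (x2 := m (Rmax (- t) 0)) in *.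
    set (x3 := m (Rmax (- (s + t)) 0)) in *.
    transitivity (m (Rmax (s + t) 0) * (x1 * x2) / (x1 * x2 * x3)).
    { field. repeat split; assumption. }
    rewrite E. field. repeat split; assumption.
  - intros eps Heps.
    destruct (Hc (Rmin (1 / 2) (eps / 2))) as [delta [Hd1 Hd2]].
    { apply Rmin_pos; lra. }
    exists delta. split; [assumption|]. intros h Hh.
    assert (Hm2 := Rmin_l (1 / 2) (eps / 2)). assert (Hm3 := Rmin_r (1 / 2) (eps / 2)).
    apply Rabs_def2 in Hh. destruct (total_order_T h 0) as [[Hlt | Heq] | Hgt].
    + rewrite HMn by assumption. specialize (Hd2 (- h)%R ltac:(lra)).
      assert (N := Hnz (- h)%R ltac:(lra)).
      set (x := m (- h)%R) in *.
      replace (/ x - 1) with (- (x - 1) / x) by (field; assumption).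
      rewrite Cmod_div, Cmod_opp by assumption.
      assert (T := Cmod_add_ge 1 (x - 1)).
      replace (1 + (x - 1)) with x in T by ring. rewrite Cmod_1 in T.
      apply Rlt_div_l; nra.
    + rewrite Heq, HM, H0 by lra. replace (1 - 1) with (RtoC 0) by ring.
      rewrite Cmod_0. assumption.
    + rewrite HM by lra. specialize (Hd2 h ltac:(lra)). lra.
  - exists mu. intros t Ht. rewrite <- HM by assumption. apply Hmu.
Qed.

(** * The complex exponential and the length of spirals *)

Lemma Cmod_Cexp (z : C) : Cmod (Cexp z) = exp (Re z).
Proof.
  unfold Cmod, Cexp. cbn [fst snd].
  assert (T := sin2_cos2 (Im z)). unfold Rsqr in T.
  replace ((exp (Re z) * cos (Im z)) ^ 2 + (exp (Re z) * sin (Im z)) ^ 2)%R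
    with (exp (Re z) ^ 2 * (sin (Im z) * sin (Im z) + cos (Im z) * cos (Im z)))%R by ring.
  rewrite T, Rmult_1_r. apply sqrt_pow2. apply Rlt_le, exp_pos.
Qed.

Lemma Cexp_plus (z w : C) : Cexp (z + w) = Cexp z * Cexp w.
Proof.
  unfold Cexp, Cmult. destruct z as [a b], w as [c d]. simpl.
  rewrite exp_plus, cos_plus, sin_plus. f_equal; ring.
Qed.

Lemma Cexp_0 : Cexp 0 = 1.
Proof. unfold Cexp. simpl. rewrite exp_0, cos_0, sin_0. apply injective_projections; simpl; ring. Qed.

(** Two logarithms of the same number differ by a multiple of [2 i PI], so the one
    in the strip [|Im| <= PI] has the smallest imaginary part in modulus. *)
Lemma Cexp_eq (mu lambda : C) :
  Cexp mu = Cexp lambda -> (Rabs (Im lambda) <= PI)%R ->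
  Re mu = Re lambda /\ (Rabs (Im lambda) <= Rabs (Im mu))%R.
Proof.
  intros E Hl.
  assert (ER : Re mu = Re lambda).
  { apply exp_inv. rewrite <- !Cmod_Cexp. f_equal. exact E. }
  split; [exact ER|].
  assert (He := exp_pos (Re lambda)).
  assert (Ec : cos (Im mu) = cos (Im lambda)).
  { apply (f_equal fst) in E. simpl in E. rewrite ER in E.
    apply Rmult_eq_reg_l in E; lra. }
  assert (Es : sin (Im mu) = sin (Im lambda)).
  { apply (f_equal snd) in E. simpl in E. rewrite ER in E.
    apply Rmult_eq_reg_l in E; lra. }
  set (x := Im mu) in *. set (y := Im lambda) in *.
  assert (H1 : cos (x - y) = 1%R).
  { rewrite cos_minus, Ec, Es. assert (T := sin2_cos2 y). unfold Rsqr in T. lra. }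
  assert (H2 : sin ((x - y) / 2) = 0%R).
  { replace (x - y)%R with (2 * ((x - y) / 2))%R in H1 by field.
    rewrite cos_2a_sin in H1. nra. }
  apply sin_eq_0_0 in H2. destruct H2 as [k Hk].
  assert (HPI := PI_RGT_0).
  destruct (Z.eq_dec k 0) as [K0 | K0].
  - rewrite K0 in Hk. replace x with y by lra. lra.
  - assert (Hx : (2 * PI <= Rabs (x - y))%R).
    { replace (x - y)%R with (IZR k * (2 * PI))%R by lra.
      rewrite Rabs_mult, (Rabs_right (2 * PI)) by lra.
      assert (1 <= Rabs (IZR k))%R; [|nra].
      rewrite <- abs_IZR. apply IZR_le. lia. }
    assert (T := Rabs_triang x (- y)). rewrite Rabs_Ropp in T.
    unfold Rminus in Hx. lra.
Qed.

Lemma Cexp_surj_circle (m : C) : Cmod m = 1%R -> exists mu, Re mu = 0%R /\ Cexp mu = m.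
Proof.
  intros H. assert (T := Cmod_sqr m). rewrite H in T.
  destruct m as [x y]. simpl in T.
  assert (Hx : (-1 <= x <= 1)%R) by nra.
  assert (Hs : (sin (acos x) = Rabs y)%R).
  { rewrite sin_acos by assumption. rewrite <- sqrt_Rsqr_abs. f_equal. unfold Rsqr. lra. }
  destruct (Rle_dec 0 y) as [Hy | Hy].
  - exists (0%R, acos x). split; [reflexivity|]. unfold Cexp. simpl.
    rewrite exp_0, Hs, cos_acos, Rabs_right by lra. f_equal; ring.
  - exists (0%R, (- acos x)%R). split; [reflexivity|]. unfold Cexp. simpl.
    rewrite exp_0, sin_neg, cos_neg, Hs, cos_acos, Rabs_left by lra. f_equal; ring.
Qed.

(** The speed is [|lambda| * exp (Re lambda * t)], whose primitive vanishes at
    infinity. *)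
Lemma length_canonical_spiral (lambda : C) :
  (Re lambda < 0)%R ->
  length_from_1 (canonical_spiral lambda)
  = (Cmod lambda * Cmod (Cexp lambda) / - Re lambda)%R.
Proof.
  intros Hl. unfold length_from_1.
  set (p := Re lambda) in *. set (th := Im lambda).
  pose (F := fun t => (Cmod lambda / p * exp (p * t))%R).
  assert (HF : forall t, is_derive F t (Cmod lambda * exp (p * t))%R).
  { intros t. unfold F. auto_derive; [trivial|]. field. lra. }
  assert (DF : forall t, Derive F t = (Cmod lambda * exp (p * t))%R)
    by (intros; apply is_derive_unique, HF).
  assert (HV : forall t, Cmod (velocity (canonical_spiral lambda) t) = Derive F t).
  { intros t. rewrite DF.
    assert (E : velocity (canonical_spiral lambda) t = lambda * Cexp (lambda * t)).
    { unfold velocity, canonical_spiral, Cexp.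
      assert (ER : forall s : R, Re (lambda * s) = (p * s)%R)
        by (intros; unfold p, Re; simpl; ring).
      assert (EI : forall s : R, Im (lambda * s) = (th * s)%R)
        by (intros; unfold th, Im; simpl; ring).
      rewrite ER, EI.
      apply injective_projections; simpl; apply is_derive_unique.
      - apply (is_derive_ext (fun s => (exp (p * s) * cos (th * s))%R)).
        + intros s. rewrite <- ER, <- EI. reflexivity.
        + auto_derive; [trivial|]. unfold p, th, Re, Im. ring.
      - apply (is_derive_ext (fun s => (exp (p * s) * sin (th * s))%R)).
        + intros s. rewrite <- ER, <- EI. reflexivity.
        + auto_derive; [trivial|]. unfold p, th, Re, Im. ring. }
    rewrite E, Cmod_mult, Cmod_Cexp.
    replace (Re (lambda * t)) with (p * t)%R by (unfold p, Re; simpl; ring).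
    reflexivity. }
  apply is_RInt_gen_unique.
  apply (is_RInt_gen_ext (Derive F)).
  { apply filter_forall. intros [u v] x _. symmetry. apply HV. }
  replace (Cmod lambda * Cmod (Cexp lambda) / - p)%R with (0 - F 1)%R.
  2:{ rewrite Cmod_Cexp. fold p. unfold F. rewrite Rmult_1_r. field. lra. }
  apply is_RInt_gen_Derive.
  - apply filter_forall. intros _ x _. eexists. apply HF.
  - apply filter_forall. intros _ x _.
    apply (continuous_ext (fun t => (Cmod lambda * exp (p * t))%R)).
    { intros t. symmetry. apply DF. }
    apply (ex_derive_continuous (V := R_NormedModule)). auto_derive. trivial.
  - intros P HP. unfold filtermap, at_point. apply (locally_singleton _ _ HP).
  - assert (L : is_lim F p_infty (Cmod lambda / p * 0)%R).
    { unfold F. apply (is_lim_scal_l _ (Cmod lambda / p) p_infty 0).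
      apply (is_lim_comp exp (fun t => (p * t)%R) p_infty 0 m_infty).
      - apply is_lim_exp_m.
      - assert (T := is_lim_scal_l (fun t => t) p p_infty p_infty (is_lim_id p_infty)).
        replace m_infty with (Rbar_mult p p_infty); [exact T|].
        simpl. destruct (Rle_dec 0 p) as [Hr | Hr]; [exfalso; lra | reflexivity].
      - exists 0%R. intros y _. discriminate. }
    rewrite Rmult_0_r in L. exact L.
Qed.

(** * Semigroups of linear fractional maps *)

(** Closes [x <> 0] from [N : y <> 0] when [x] and [y] agree up to ring identities. *)
Ltac nonzero_by_ring N :=
  match goal with
  | |- _ <> _ => intros HnzE; apply N; rewrite <- HnzE; ring
  end.

Lemma nonzero_of_Cmod_lt (z w : C) : (Cmod z < Cmod w)%R -> w <> 0.
Proof.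
  intros H. apply Cmod_gt_0. assert (T := Cmod_ge_0 z). lra.
Qed.

Lemma denominator_nonzero (c d z : C) :
  (Cmod c < Cmod d)%R -> (Cmod z <= 1)%R -> c * z + d <> 0.
Proof.
  intros H Hz. apply Cmod_gt_0.
  assert (T := Cmod_add_ge d (c * z)). rewrite Cmod_mult in T.
  assert (T2 := Cmod_ge_0 c). assert (T3 := Cmod_ge_0 z).
  replace (c * z + d) with (d + c * z) by ring. nra.
Qed.

Lemma one_minus_nonzero (sigma z : C) :
  (Cmod sigma <= 1)%R -> (Cmod z < 1)%R -> 1 - sigma * z <> 0.
Proof.
  intros H Hz. apply Cmod_gt_0.
  assert (T := Cmod_sub_ge 1 (sigma * z)). rewrite Cmod_mult, Cmod_1 in T.
  assert (T2 := Cmod_ge_0 sigma). assert (T3 := Cmod_ge_0 z). nra.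
Qed.

Lemma continuous_Cmod (f : R -> C) (x : R) :
  continuous f x ->
  forall eps, (0 < eps)%R -> exists delta, (0 < delta)%R /\
    forall t, (Rabs (t - x) < delta)%R -> (Cmod (f t - f x) < eps)%R.
Proof.
  intros H eps Heps.
  assert (L : locally (f x) (fun y => (Cmod (y - f x) < eps)%R)).
  { apply (locally_le_locally_norm (V := C_NormedModule)).
    exists (mkposreal eps Heps). intros y Hy. exact Hy. }
  destruct (H _ L) as [delta Hd].
  exists delta. split; [apply cond_pos|]. intros t Ht. apply Hd, Ht.
Qed.

Lemma continuous_Cpair (x y : R -> R) (t : R) :
  continuous x t -> continuous y t -> continuous (fun s => (x s, y s) : C) t.
Proof.
  intros Hx Hy. apply (continuous_comp_2 x y (fun a b => (a, b) : C)); [exact Hx | exact Hy |].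
  apply (continuous_ext (fun p : R * R => p)).
  - intros [a b]. reflexivity.
  - apply continuous_id.
Qed.

Lemma continuous_Cexp_line (mu : C) (t : R) :
  continuous (fun s : R => Cexp (mu * s)) t.
Proof.
  apply continuous_Cpair; apply (ex_derive_continuous (V := R_NormedModule));
    unfold Re, Im; simpl; auto_derive; trivial.
Qed.

(** A family of coefficient matrices that multiplies like a one-parameter group
    up to the scalar [kappa] acts as a semigroup.  As [t] tends to [0] the matrix
    tends to [kappa] times the identity, and the denominators stay away from [0] on
    the whole disc, so the convergence to the identity is uniform on the disc. *)
Lemma mobius_semigroup (alpha beta gamma delta : R -> C) (kappa : C) :
  kappa <> 0 ->
  alpha 0%R = kappa -> beta 0%R = 0 -> gamma 0%R = 0 -> delta 0%R = kappa ->
  continuous alpha 0%R ->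
  continuous beta 0%R ->
  continuous gamma 0%R ->
  continuous delta 0%R ->
  (forall t z, (0 <= t)%R -> unit_disc z ->
     (Cmod (alpha t * z + beta t) < Cmod (gamma t * z + delta t))%R) ->
  (forall t s,
     alpha t * alpha s + beta t * gamma s = kappa * alpha (t + s)%R /\
     alpha t * beta s + beta t * delta s = kappa * beta (t + s)%R /\
     gamma t * alpha s + delta t * gamma s = kappa * gamma (t + s)%R /\
     gamma t * beta s + delta t * delta s = kappa * delta (t + s)%R) ->
  semigroup_in_disc (fun t => mobius (alpha t) (beta t) (gamma t) (delta t)).
Proof.
  intros Hk Ha0 Hb0 Hg0 Hd0 Ca Cb Cg Cd Hlt Hprod.
  assert (Hnz : forall t z, (0 <= t)%R -> unit_disc z -> gamma t * z + delta t <> 0).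
  { intros t z Ht Hz. exact (nonzero_of_Cmod_lt _ _ (Hlt t z Ht Hz)). }
  repeat split.
  - intros z Hz. unfold unit_disc, mobius. rewrite Cmod_div by auto.
    assert (T := Hlt t z H Hz). assert (T0 := Cmod_ge_0 (alpha t * z + beta t)).
    apply Rlt_div_l; lra.
  - intros z Hz. eexists. apply is_derive_mobius. auto.
  - intros z Hz. unfold mobius. rewrite Ha0, Hb0, Hg0, Hd0. field.
    intros E. apply Hk. rewrite <- E. ring.
  - intros t s z Ht Hs Hz.
    destruct (Hprod t s) as [P1 [P2 [P3 P4]]].
    assert (N1 := Hnz (t + s)%R z (Rplus_le_le_0_compat _ _ Ht Hs) Hz).
    assert (N2 := Hnz s z Hs Hz).
    assert (N3 : kappa * gamma (t + s)%R * z + kappa * delta (t + s)%R <> 0).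
    { replace (kappa * gamma (t + s)%R * z + kappa * delta (t + s)%R)
        with (kappa * (gamma (t + s)%R * z + delta (t + s)%R)) by ring.
      apply Cmult_neq_0; assumption. }
    unfold mobius.
    transitivity ((kappa * alpha (t + s)%R * z + kappa * beta (t + s)%R)
                  / (kappa * gamma (t + s)%R * z + kappa * delta (t + s)%R)).
    { field. split; assumption. }
    rewrite <- P1, <- P2. rewrite <- P3, <- P4 in N3 |- *.
    field. repeat split; try assumption.
    intros E. apply N3. rewrite <- E. ring.
  - intros K _ HK eps Heps.
    set (k := Cmod kappa). assert (Hk0 : (0 < k)%R) by (apply Cmod_gt_0, Hk).
    set (e := Rmin 1 eps).
    assert (He : (0 < e)%R) by (apply Rmin_pos; lra).
    assert (He1 : (e <= 1)%R) by apply Rmin_l. assert (He2 : (e <= eps)%R) by apply Rmin_r.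
    (* coefficients within [eta] of their limits give a numerator below [k * e / 2]
       and a denominator of at least [3 * k / 4] *)
    set (eta := (k * e / 8)%R).
    assert (Heta : (0 < eta)%R) by (unfold eta; nra).
    destruct (continuous_Cmod _ _ Ca eta Heta) as [r1 [R1 Q1]].
    destruct (continuous_Cmod _ _ Cb eta Heta) as [r2 [R2 Q2]].
    destruct (continuous_Cmod _ _ Cg eta Heta) as [r3 [R3 Q3]].
    destruct (continuous_Cmod _ _ Cd eta Heta) as [r4 [R4 Q4]].
    exists (Rmin (Rmin r1 r2) (Rmin r3 r4)). split.
    { repeat apply Rmin_pos; assumption. }
    intros t z [Ht0 Ht] Hz. specialize (HK z Hz). clear Hz.
    assert (M1 := Rmin_l (Rmin r1 r2) (Rmin r3 r4)).
    assert (M2 := Rmin_r (Rmin r1 r2) (Rmin r3 r4)).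
    assert (M3 := Rmin_l r1 r2). assert (M4 := Rmin_r r1 r2).
    assert (M5 := Rmin_l r3 r4). assert (M6 := Rmin_r r3 r4).
    assert (Et : Rabs (t - 0) = t) by (rewrite Rabs_right; lra).
    specialize (Q1 t ltac:(lra)). specialize (Q2 t ltac:(lra)).
    specialize (Q3 t ltac:(lra)). specialize (Q4 t ltac:(lra)).
    rewrite Ha0 in Q1. rewrite Hb0 in Q2. rewrite Hg0 in Q3. rewrite Hd0 in Q4.
    assert (N := Hnz t z ltac:(lra) HK).
    unfold unit_disc in HK. assert (Hz0 := Cmod_ge_0 z).
    unfold mobius.
    replace ((alpha t * z + beta t) / (gamma t * z + delta t) - z)
      with (((alpha t - kappa) * z + (beta t - 0) - (gamma t - 0) * (z * z)
             - (delta t - kappa) * z) / (gamma t * z + delta t)) by (field; exact N).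
    rewrite Cmod_div by exact N.
    assert (U : forall x y u v : C,
      (Cmod (x * z + y - u * (z * z) - v * z) <= Cmod x + Cmod y + Cmod u + Cmod v)%R).
    { intros x y u v.
      assert (B : forall q r : C, (Cmod r <= 1)%R -> (Cmod (q * r) <= Cmod q)%R).
      { intros q r Hr. rewrite Cmod_mult. assert (T := Cmod_ge_0 q).
        assert (T2 := Cmod_ge_0 r). nra. }
      assert (B1 := B x z ltac:(lra)). assert (B2 := B v z ltac:(lra)).
      assert (B3 := B u (z * z)). rewrite Cmod_mult in B3.
      specialize (B3 ltac:(nra)).
      assert (T1 := Cmod_triangle (x * z + y - u * (z * z)) (- (v * z))).
      assert (T2 := Cmod_triangle (x * z + y) (- (u * (z * z)))).
      assert (T3 := Cmod_triangle (x * z) y).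
      rewrite !Cmod_opp in *.
      unfold Cminus. unfold Cminus in T1. lra. }
    assert (U' := U (alpha t - kappa) (beta t - 0) (gamma t - 0) (delta t - kappa)).
    assert (D1 : (k - 2 * eta <= Cmod (gamma t * z + delta t))%R).
    { assert (T1 := Cmod_add_ge kappa ((delta t - kappa) + (gamma t - 0) * z)).
      assert (T2 := Cmod_triangle (delta t - kappa) ((gamma t - 0) * z)).
      rewrite Cmod_mult in T2. fold k in T1.
      replace (kappa + (delta t - kappa + (gamma t - 0) * z))
        with (gamma t * z + delta t) in T1 by ring.
      assert (T3 := Cmod_ge_0 (gamma t - 0)). nra. }
    assert (Hek : (8 * eta = k * e)%R) by (unfold eta; field).
    assert (k * e <= k)%R by nra.
    apply Rlt_div_l; [lra|].
    apply Rle_lt_trans with (1 := U').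
    assert (D2 : (eps * (k / 2) <= eps * Cmod (gamma t * z + delta t))%R)
      by (apply Rmult_le_compat_l; lra).
    assert (k * e <= k * eps)%R by (apply Rmult_le_compat_l; lra). lra.
Qed.

(** * The coordinate adapted to an inner fixed point *)

(** For a linear fractional map with fixed points [tau] and [1 / sigma] this is the
    Koenigs map: it conjugates the map to a multiplication.  The case [sigma = 0]
    is that of a second fixed point at infinity. *)
Definition koenigs (tau sigma : C) : C -> C := mobius 1 (- tau) (- sigma) 1.
Definition koenigs_inv (tau sigma : C) : C -> C := mobius 1 tau sigma 1.
Definition koenigs_image (tau sigma w : C) : Prop :=
  (quad (1 - Cmod sigma ^ 2) (Cconj tau - sigma) w < 1 - Cmod tau ^ 2)%R.

Lemma koenigs_image_iff (tau sigma w : C) :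
  koenigs_image tau sigma w <-> (Cmod (w + tau) < Cmod (1 + sigma * w))%R.
Proof.
  unfold koenigs_image. assert (E := disc_quad sigma tau w).
  assert (P1 := Cmod_ge_0 (w + tau)). assert (P2 := Cmod_ge_0 (1 + sigma * w)).
  split; intros H.
  - apply Rnot_le_lt. intros H'.
    assert (Cmod (1 + sigma * w) ^ 2 <= Cmod (w + tau) ^ 2)%R by (apply pow_incr; lra).
    lra.
  - assert (Cmod (w + tau) ^ 2 < Cmod (1 + sigma * w) ^ 2)%R by nra. lra.
Qed.

Section Koenigs.
Variables tau sigma : C.
Hypothesis Htau : (Cmod tau < 1)%R.
Hypothesis Hsigma : (Cmod sigma <= 1)%R.

Lemma koenigs_one_plus z :
  unit_disc z -> 1 + sigma * koenigs tau sigma z = (1 - sigma * tau) / (1 - sigma * z).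
Proof.
  intros Hz. unfold koenigs, mobius. assert (N := one_minus_nonzero sigma z Hsigma Hz).
  field. nonzero_by_ring N.
Qed.

Lemma koenigs_one_plus_nonzero z :
  unit_disc z -> 1 + sigma * koenigs tau sigma z <> 0.
Proof.
  intros Hz. rewrite koenigs_one_plus by assumption. intros E.
  assert (N := one_minus_nonzero sigma z Hsigma Hz).
  apply (one_minus_nonzero sigma tau Hsigma Htau).
  transitivity ((1 - sigma * tau) / (1 - sigma * z) * (1 - sigma * z)).
  - field. exact N.
  - rewrite E. ring.
Qed.

Lemma koenigsK z : unit_disc z -> koenigs_inv tau sigma (koenigs tau sigma z) = z.
Proof.
  intros Hz. assert (N := one_minus_nonzero sigma z Hsigma Hz).
  assert (N1 := one_minus_nonzero sigma tau Hsigma Htau).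
  unfold koenigs_inv, mobius.
  replace (sigma * koenigs tau sigma z + 1) with (1 + sigma * koenigs tau sigma z) by ring.
  rewrite koenigs_one_plus by assumption. unfold koenigs, mobius.
  field. repeat split; first [assumption | nonzero_by_ring N | nonzero_by_ring N1].
Qed.

Lemma koenigs_in_image z : unit_disc z -> koenigs_image tau sigma (koenigs tau sigma z).
Proof.
  intros Hz. apply koenigs_image_iff.
  assert (N := koenigs_one_plus_nonzero z Hz).
  set (w := koenigs tau sigma z) in *.
  replace (w + tau) with (koenigs_inv tau sigma w * (1 + sigma * w)).
  - rewrite Cmod_mult. unfold w at 1. rewrite koenigsK by assumption.
    assert (T := proj1 (Cmod_gt_0 _) N). unfold unit_disc in Hz. nra.
  - unfold koenigs_inv, mobius. field. intros E. apply N. rewrite <- E. ring.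
Qed.

Lemma koenigs_image_nonzero w : koenigs_image tau sigma w -> sigma * w + 1 <> 0.
Proof.
  intros H. apply koenigs_image_iff, nonzero_of_Cmod_lt in H.
  intros E. apply H. rewrite <- E. ring.
Qed.

Lemma koenigs_inv_in_disc w : koenigs_image tau sigma w -> unit_disc (koenigs_inv tau sigma w).
Proof.
  intros H. assert (N := koenigs_image_nonzero w H). apply koenigs_image_iff in H.
  unfold unit_disc, koenigs_inv, mobius. rewrite Cmod_div by exact N.
  replace (1 * w + tau) with (w + tau) by ring.
  replace (sigma * w + 1) with (1 + sigma * w) in * by ring.
  assert (T := proj1 (Cmod_gt_0 _) N). apply Rlt_div_l; lra.
Qed.

Lemma koenigs_invK w : koenigs_image tau sigma w -> koenigs tau sigma (koenigs_inv tau sigma w) = w.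
Proof.
  intros H. assert (N := koenigs_image_nonzero w H).
  assert (N1 := one_minus_nonzero sigma tau Hsigma Htau).
  unfold koenigs, koenigs_inv, mobius. field. split; [exact N|].
  intros E. apply N1. rewrite <- E. ring.
Qed.

Lemma koenigs_eq0 z : unit_disc z -> koenigs tau sigma z = 0 -> z = tau.
Proof.
  intros Hz E. rewrite <- (koenigsK z Hz), E. unfold koenigs_inv, mobius. field.
Qed.

Lemma koenigs_tau : koenigs tau sigma tau = 0.
Proof.
  unfold koenigs, mobius. replace (1 * tau + - tau) with (RtoC 0) by ring.
  unfold Cdiv. ring.
Qed.

(** The semigroup is [z |-> k (exp (mu * t) * h z)], with [h] the Koenigs map and
    [k] its inverse, written out as a family of linear fractional maps. *)
Lemma elliptic_embedding (f : C -> C) (mu : C) :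
  (Re mu <= 0)%R ->
  (Cmod (Cconj tau - sigma) ^ 2 * Im mu ^ 2
     <= Re mu ^ 2 * ((1 - Cmod sigma ^ 2) * (1 - Cmod tau ^ 2)))%R ->
  maps_disc_into_disc f ->
  (forall z, unit_disc z -> koenigs tau sigma (f z) = Cexp mu * koenigs tau sigma z) ->
  embeddable f.
Proof.
  intros Hmu Hcond Hf Hconj.
  pose (E := fun t : R => Cexp (mu * t)).
  assert (E0 : E 0%R = 1).
  { unfold E. replace (mu * 0%R) with (RtoC 0) by ring. apply Cexp_0. }
  assert (E1 : E 1%R = Cexp mu).
  { unfold E. f_equal. ring. }
  assert (ED : forall t s, E (t + s)%R = E t * E s).
  { intros t s. unfold E. rewrite <- Cexp_plus. f_equal. rewrite RtoC_plus. ring. }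
  assert (EC : continuous E 0%R).
  { apply continuous_Cexp_line. }
  assert (CA : forall u v : C, continuous (fun t => u * E t + v) 0%R).
  { intros u v. apply (continuous_plus (V := C_NormedModule) (fun t => u * E t) (fun _ => v)).
    - apply (continuous_scal_r (V := C_NormedModule) u E). exact EC.
    - apply continuous_const. }
  assert (N1 := one_minus_nonzero sigma tau Hsigma Htau).
  assert (Hnum : forall t z, unit_disc z ->
     (1 * E t + - (tau * sigma)) * z + (- tau * E t + tau)
     = (E t * koenigs tau sigma z + tau) * (1 - sigma * z)).
  { intros t z Hz. assert (N := one_minus_nonzero sigma z Hsigma Hz).
    unfold koenigs, mobius. field. intros E'. apply N. rewrite <- E'. ring. }
  assert (Hden : forall t z, unit_disc z ->
     (sigma * E t + - sigma) * z + (- (sigma * tau) * E t + 1)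
     = (1 + sigma * (E t * koenigs tau sigma z)) * (1 - sigma * z)).
  { intros t z Hz. assert (N := one_minus_nonzero sigma z Hsigma Hz).
    unfold koenigs, mobius. field. intros E'. apply N. rewrite <- E'. ring. }
  assert (HA : (0 <= 1 - Cmod sigma ^ 2)%R).
  { assert (T := Cmod_ge_0 sigma). nra. }
  assert (HC : (0 < 1 - Cmod tau ^ 2)%R).
  { assert (T := Cmod_ge_0 tau). nra. }
  assert (Hinv : forall t z, (0 <= t)%R -> unit_disc z ->
     koenigs_image tau sigma (E t * koenigs tau sigma z)).
  { intros t z Ht Hz. apply spiral_invariance; try assumption.
    apply koenigs_in_image, Hz. }
  exists (fun t => mobius (1 * E t + - (tau * sigma)) (- tau * E t + tau)
                          (sigma * E t + - sigma) (- (sigma * tau) * E t + 1)).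
  split.
  - apply (mobius_semigroup (fun t => 1 * E t + - (tau * sigma)) (fun t => - tau * E t + tau)
             (fun t => sigma * E t + - sigma) (fun t => - (sigma * tau) * E t + 1)
             (1 - sigma * tau)); try apply CA; try (rewrite E0; ring); try assumption.
    + intros t z Ht Hz. rewrite Hnum, Hden, !Cmod_mult by assumption.
      apply Rmult_lt_compat_r.
      * apply Cmod_gt_0, one_minus_nonzero; assumption.
      * apply koenigs_image_iff, Hinv; assumption.
    + intros t s. rewrite ED. repeat split; ring.
  - intros z Hz. unfold mobius. rewrite Hnum, Hden by assumption.
    assert (N := one_minus_nonzero sigma z Hsigma Hz).
    rewrite E1, <- Hconj by assumption.
    rewrite <- (koenigsK (f z)) by (apply Hf; assumption).
    assert (N2 := koenigs_one_plus_nonzero _ (Hf z Hz)).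
    rewrite koenigsK by (apply Hf; assumption).
    transitivity (koenigs_inv tau sigma (koenigs tau sigma (f z))).
    + unfold koenigs_inv, mobius. field. repeat split; try assumption.
      intros E'. apply N2. rewrite <- E'. ring.
    + apply koenigsK, Hf, Hz.
Qed.



(** * Maps that commute with a multiplication *)

(** [F w - l * w] scales like [m ^ n] along the points [m ^ n * w], whereas
    differentiability at [0] makes it [o (m ^ n)] there. *)
Lemma linear_of_homogeneous (F : C -> C) (l m w : C) :
  F 0 = 0 -> is_derive (K := C_AbsRing) (V := C_NormedModule) F (RtoC 0) l ->
  m <> 0 -> (Cmod m < 1)%R ->
  (forall n : nat, F (m ^ n * w) = m ^ n * F w) ->
  F w = l * w.
Proof.
  intros F0 HF Hm Hm1 Hom.
  assert (Hle : forall eps, (0 < eps)%R -> (Cmod (F w - l * w) <= eps * Cmod w)%R).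
  { intros eps Heps.
    destruct (proj1 (is_C_derive_iff F 0 l) HF eps Heps) as [delta [Hd1 Hd2]].
    assert (Hw := Cmod_ge_0 w).
    destruct (pow_lt_1_zero (Cmod m)) with (y := (delta / (Cmod w + 1))%R) as [n Hn].
    { rewrite Rabs_right; [assumption | apply Rle_ge, Cmod_ge_0]. }
    { apply Rdiv_lt_0_compat; lra. }
    specialize (Hn n (le_n n)). rewrite <- Cmod_pow, Rabs_right in Hn
      by apply Rle_ge, Cmod_ge_0.
    assert (Hmn : m ^ n <> 0) by (apply Cpow_nz; assumption).
    assert (Hp := proj1 (Cmod_gt_0 _) Hmn).
    specialize (Hd2 (m ^ n * w)).
    rewrite Hom, F0 in Hd2.
    replace (m ^ n * w - 0) with (m ^ n * w) in Hd2 by ring.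
    replace (m ^ n * F w - 0 - m ^ n * w * l) with (m ^ n * (F w - l * w)) in Hd2 by ring.
    rewrite !Cmod_mult in Hd2.
    apply Rmult_le_reg_l with (1 := Hp).
    rewrite <- Rmult_assoc, (Rmult_comm _ eps), Rmult_assoc. apply Hd2.
    replace delta with (delta / (Cmod w + 1) * (Cmod w + 1))%R by (field; lra).
    apply Rmult_le_0_lt_compat; lra. }
  assert (E : F w - l * w = 0).
  { apply Cmod_eq_0. assert (T := Cmod_ge_0 (F w - l * w)). assert (Hw := Cmod_ge_0 w).
    apply Rle_antisym; [|assumption]. apply Rnot_lt_le. intros H.
    specialize (Hle (Cmod (F w - l * w) / (2 * (Cmod w + 1)))%R).
    assert (0 < Cmod (F w - l * w) / (2 * (Cmod w + 1)))%R as H1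
      by (apply Rdiv_lt_0_compat; lra).
    specialize (Hle H1).
    set (x := Cmod (F w - l * w)) in *.
    assert (x / (2 * (Cmod w + 1)) * (2 * (Cmod w + 1)) = x)%R by (field; lra). nra. }
  transitivity (F w - l * w + l * w); [ring | rewrite E; ring].
Qed.

(** A map commuting with [f] fixes the only fixed point [tau] of [f] in the disc,
    and in the Koenigs coordinate it commutes with the multiplication by [m]. *)
Lemma commuting_map_linear (f g : C -> C) (m : C) :
  m <> 0 -> (Cmod m < 1)%R ->
  maps_disc_into_disc f -> maps_disc_into_disc g -> holomorphic_on_disc g ->
  (forall z, unit_disc z -> g (f z) = f (g z)) ->
  (forall z, unit_disc z -> koenigs tau sigma (f z) = m * koenigs tau sigma z) ->
  exists l : C, forall z, unit_disc z ->
    koenigs tau sigma (g z) = l * koenigs tau sigma z.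
Proof.
  intros Hm Hm1 Hf Hg Hol Hcomm Hconj.
  assert (Hg0 : g tau = tau).
  { assert (Hft : f tau = tau).
    { apply koenigs_eq0; [apply Hf, Htau|]. rewrite Hconj, koenigs_tau by exact Htau. ring. }
    apply koenigs_eq0; [apply Hg, Htau|].
    assert (E := Hconj (g tau) (Hg tau Htau)).
    rewrite <- Hcomm, Hft in E by exact Htau.
    set (x := koenigs tau sigma (g tau)) in *.
    assert (N : 1 - m <> 0).
    { apply Cmod_gt_0. assert (T := Cmod_sub_ge 1 m). rewrite Cmod_1 in T. lra. }
    transitivity ((x - m * x) / (1 - m)); [field; exact N|].
    rewrite <- E. unfold Cdiv. ring. }
  pose (F := fun w => koenigs tau sigma (g (koenigs_inv tau sigma w))).
  assert (K0 : koenigs_inv tau sigma 0 = tau) by (unfold koenigs_inv, mobius; field).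
  assert (HF : exists l, is_derive (K := C_AbsRing) (V := C_NormedModule) F (RtoC 0) l).
  { destruct (Hol tau Htau) as [dg Hdg].
    assert (N1 := one_minus_nonzero sigma tau Hsigma Htau).
    eexists. unfold F. apply (is_C_derive_comp (koenigs tau sigma)
                       (fun w => g (koenigs_inv tau sigma w))).
    - apply (is_C_derive_comp g (koenigs_inv tau sigma)).
      + apply is_derive_mobius. replace (sigma * 0 + 1) with (RtoC 1) by ring. apply C1_nz.
      + rewrite K0. exact Hdg.
    - rewrite K0, Hg0. apply is_derive_mobius. nonzero_by_ring N1. }
  destruct HF as [l Hl]. exists l. intros z Hz.
  rewrite <- (koenigsK z Hz) at 1.
  apply (linear_of_homogeneous F l m).
  - unfold F. rewrite K0, Hg0. apply koenigs_tau.
  - exact Hl.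
  - exact Hm.
  - exact Hm1.
  - intros n.
    assert (Hn : exists y, unit_disc y /\ koenigs tau sigma y = m ^ n * koenigs tau sigma z
              /\ F (koenigs tau sigma y) = m ^ n * F (koenigs tau sigma z)).
    { induction n as [|n [y [Hy [E1 E2]]]].
      - exists z. rewrite !Cmult_1_l. auto.
      - exists (f y). repeat split; [apply Hf, Hy | |].
        + rewrite Hconj, E1, Cpow_S by assumption. ring.
        + rewrite Cpow_S, <- Cmult_assoc, <- E2. unfold F.
          rewrite !koenigsK by (try apply Hf; assumption).
          rewrite Hcomm, Hconj by (try apply Hg; assumption). reflexivity. }
    destruct Hn as [y [_ [E1 E2]]]. rewrite <- E1. exact E2.
Qed.

(** Each [phi t] commutes with [phi 1 = f], hence is a multiplication in the
    Koenigs coordinate; the factor is read off at a single point [z0], where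
    the continuity of the semigroup at time [0] is that of the factor. *)
Lemma embeddable_spiral (f : C -> C) (m : C) :
  m <> 0 -> (Cmod m < 1)%R -> maps_disc_into_disc f ->
  (forall z, unit_disc z -> koenigs tau sigma (f z) = m * koenigs tau sigma z) ->
  embeddable f ->
  exists mu, Cexp mu = m /\
    forall w t, koenigs_image tau sigma w -> (0 <= t)%R ->
      koenigs_image tau sigma (Cexp (mu * t) * w).
Proof.
  intros Hm Hm1 Hf Hconj [phi [[Hself [Hid [Hsg Hcont]]] Hphi1]].
  assert (Hz0 : exists z0, unit_disc z0 /\ z0 <> tau).
  { destruct (Ceq_dec tau 0) as [E | N].
    - exists (RtoC (1 / 2)). split.
      + unfold unit_disc. rewrite Cmod_R, Rabs_right; lra.
      + rewrite E. intros E'. apply RtoC_inj in E'. lra.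
    - exists 0. split; [unfold unit_disc; rewrite Cmod_0; lra | auto]. }
  destruct Hz0 as [z0 [Hz0 Nz0]].
  set (h := koenigs tau sigma) in *.
  assert (Nh : h z0 <> 0) by (intros E; apply Nz0, koenigs_eq0; assumption).
  pose (M := fun t => h (phi t z0) / h z0).
  assert (HM : forall t z, (0 <= t)%R -> unit_disc z -> h (phi t z) = M t * h z).
  { intros t z Ht Hz.
    destruct (commuting_map_linear f (phi t) m) as [l Hl]; try assumption;
      try apply Hself; try assumption.
    - intros y Hy. rewrite <- !Hphi1 by (try apply Hself; assumption).
      rewrite <- !Hsg by (try lra; assumption). f_equal. ring.
    - fold h in Hl. unfold M. rewrite (Hl z0 Hz0), (Hl z Hz). field. exact Nh. }
  destruct (one_parameter_semigroup_spiral M) as [mu Hmu].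
  - unfold M. rewrite Hid by assumption. field. exact Nh.
  - assert (E : M 1%R = m).
    { unfold M. rewrite Hphi1, Hconj by assumption. fold h. field. exact Nh. }
    rewrite E. exact Hm.
  - intros s t Hs Ht. unfold M at 1. rewrite Hsg by assumption.
    rewrite HM by (try apply Hself; assumption). rewrite HM by assumption.
    field. exact Nh.
  - intros eps Heps.
    assert (N := one_minus_nonzero sigma z0 Hsigma Hz0).
    assert (Hc : exists d, (0 < d)%R /\ forall y, (Cmod (y - z0) < d)%R ->
                   (Cmod (h y - h z0) < eps * Cmod (h z0))%R).
    { assert (D : is_derive (K := C_AbsRing) (V := C_NormedModule) h z0 _)
        by (apply is_derive_mobius; nonzero_by_ring N).
      assert (Hh := proj1 (Cmod_gt_0 _) Nh).
      assert (L : locally (h z0) (fun y => (Cmod (y - h z0) < eps * Cmod (h z0))%R)).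
      { apply (locally_le_locally_norm (V := C_NormedModule)).
        exists (mkposreal _ (Rmult_lt_0_compat _ _ Heps Hh)). intros y Hy. exact Hy. }
      destruct (ex_derive_continuous (K := C_AbsRing) (V := C_NormedModule) h z0
                  (ex_intro _ _ D) _ L) as [d Hd].
      exists d. split; [apply cond_pos|]. intros y Hy. apply Hd. exact Hy. }
    destruct Hc as [d [Hd1 Hd2]].
    destruct (Hcont (fun z => z = z0)) with (eps := d) as [delta [Hdel1 Hdel2]].
    + intros I U _ HU. destruct (HU z0 eq_refl) as [i Hi].
      exists (i :: nil). intros z ->. exists i. split; [left; reflexivity | exact Hi].
    + intros z ->. exact Hz0.
    + exact Hd1.
    + exists delta. split; [assumption|]. intros t Ht.
      specialize (Hd2 _ (Hdel2 t z0 Ht eq_refl)).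
      unfold M. replace (h (phi t z0) / h z0 - 1) with ((h (phi t z0) - h z0) / h z0)
        by (field; exact Nh).
      rewrite Cmod_div by exact Nh. apply Rlt_div_l; [apply Cmod_gt_0, Nh | exact Hd2].
  - exists mu. split.
    + transitivity (M 1%R).
      * rewrite Hmu by lra. f_equal. ring.
      * unfold M. rewrite Hphi1, Hconj by assumption. fold h. field. exact Nh.
    + intros w t Hw Ht. rewrite <- Hmu by assumption.
      rewrite <- (koenigs_invK w Hw). fold h.
      assert (Hk := koenigs_inv_in_disc w Hw).
      rewrite <- HM by assumption. apply koenigs_in_image. apply Hself; assumption.
Qed.

End Koenigs.

(** * The half-plane model of a boundary fixed point *)

(** The Cayley transform that sends the boundary point [tau] to infinity and the
    disc to the right half-plane. *)
Definition cayley (tau : C) : C -> C := fun z => (tau + z) / (tau - z).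

Lemma Cmod_sub1_lt_add1 (x : C) : (Cmod (x - 1) < Cmod (x + 1))%R <-> (0 < Re x)%R.
Proof.
  assert (E : (Cmod (x + 1) ^ 2 - Cmod (x - 1) ^ 2 = 4 * Re x)%R).
  { rewrite !Cmod_sqr. destruct x; simpl; ring. }
  assert (P1 := Cmod_ge_0 (x - 1)). assert (P2 := Cmod_ge_0 (x + 1)).
  split; intros H; [nra|].
  apply Rnot_le_lt. intros H'.
  assert (Cmod (x + 1) ^ 2 <= Cmod (x - 1) ^ 2)%R by (apply pow_incr; lra). lra.
Qed.

Section Cayley.
Variable tau : C.
Hypothesis Htau : Cmod tau = 1%R.

Lemma unit_circle_nonzero : tau <> 0.
Proof. apply Cmod_gt_0. lra. Qed.

Lemma tau_sub_nonzero z : unit_disc z -> tau - z <> 0.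
Proof.
  intros Hz. apply Cmod_gt_0. assert (T := Cmod_sub_ge tau z). unfold unit_disc in Hz. lra.
Qed.

Lemma cayley_Re_pos z : unit_disc z -> (0 < Re (cayley tau z))%R.
Proof.
  intros Hz. assert (N := tau_sub_nonzero z Hz). assert (N0 := unit_circle_nonzero).
  apply Cmod_sub1_lt_add1. unfold cayley.
  replace ((tau + z) / (tau - z) - 1) with (2 * z / (tau - z)) by (field; exact N).
  replace ((tau + z) / (tau - z) + 1) with (2 * tau / (tau - z)) by (field; exact N).
  rewrite !Cmod_div, !Cmod_mult, Htau by exact N.
  apply Rmult_lt_compat_r; [apply Rinv_0_lt_compat, Cmod_gt_0, N|].
  apply Rmult_lt_compat_l; [|exact Hz]. rewrite Cmod_R, Rabs_right; lra.
Qed.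

Lemma cayley_inv_in_disc x : (0 < Re x)%R ->
  unit_disc (tau * (x - 1) / (x + 1)) /\ cayley tau (tau * (x - 1) / (x + 1)) = x.
Proof.
  intros Hx. assert (N0 := unit_circle_nonzero). apply Cmod_sub1_lt_add1 in Hx.
  assert (N := nonzero_of_Cmod_lt _ _ Hx). split.
  - unfold unit_disc. rewrite Cmod_div, Cmod_mult, Htau, Rmult_1_l by exact N.
    apply Rlt_div_l; [apply Cmod_gt_0, N | lra].
  - unfold cayley. field. split; [exact N|].
    intros E. apply N0.
    transitivity ((tau * (x + 1) - tau * (x - 1)) / 2); [field | rewrite E; field].
Qed.

Lemma cayleyK z : unit_disc z -> tau * (cayley tau z - 1) / (cayley tau z + 1) = z.
Proof.
  intros Hz. assert (N := tau_sub_nonzero z Hz). assert (N0 := unit_circle_nonzero).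
  unfold cayley. field. split; [exact N|].
  intros E. apply N0. transitivity ((tau + z + (tau - z)) / 2); [field | rewrite E; field].
Qed.

(** [x |-> exp (p * t) * x + k t * b] is a semigroup of affine maps as soon as [k]
    is a cocycle for [exp (p * t)]; it preserves the half-plane because [k t] and
    [Re b] are nonnegative. *)
Lemma half_plane_embedding (f : C -> C) (p : R) (b : C) (k : R -> R) :
  (0 <= Re b)%R ->
  k 0%R = 0%R -> k 1%R = 1%R -> continuous k 0%R ->
  (forall t, (0 <= t)%R -> (0 <= k t)%R) ->
  (forall t s, k (t + s)%R = (exp (p * t) * k s + k t)%R) ->
  maps_disc_into_disc f ->
  (forall z, unit_disc z -> cayley tau (f z) = exp p * cayley tau z + b) ->
  embeddable f.
Proof.
  intros Hb k0 k1 kc kp kD Hf Hconj.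
  assert (N0 := unit_circle_nonzero).
  pose (A := fun t : R => RtoC (exp (p * t))).
  pose (B := fun t : R => b * k t).
  assert (A0 : A 0%R = 1) by (unfold A; rewrite Rmult_0_r, exp_0; reflexivity).
  assert (B0 : B 0%R = 0) by (unfold B; rewrite k0; ring).
  assert (AD : forall t s, A (t + s)%R = A t * A s).
  { intros t s. unfold A. rewrite <- RtoC_mult, <- exp_plus. do 2 f_equal. ring. }
  assert (BD : forall t s, B (t + s)%R = A t * B s + B t).
  { intros t s. unfold A, B. rewrite kD, RtoC_plus, RtoC_mult. ring. }
  assert (AC : continuous A 0%R).
  { apply continuous_Cpair; [|apply continuous_const].
    apply (ex_derive_continuous (V := R_NormedModule)). auto_derive. trivial. }
  assert (BC : continuous B 0%R).
  { apply (continuous_scal_r (V := C_NormedModule) b (fun t => RtoC (k t))).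
    apply continuous_Cpair; [exact kc | apply continuous_const]. }
  assert (CA : forall u v w : C, continuous (fun t => u * A t + v * B t + w) 0%R).
  { intros u v w.
    apply (continuous_plus (V := C_NormedModule) (fun t => u * A t + v * B t) (fun _ => w));
      [|apply continuous_const].
    apply (continuous_plus (V := C_NormedModule) (fun t => u * A t) (fun t => v * B t)).
    - apply (continuous_scal_r (V := C_NormedModule) u A). exact AC.
    - apply (continuous_scal_r (V := C_NormedModule) v B). exact BC. }
  (* coefficients of the inverse Cayley transform after [x |-> A t * x + B t] after
     the Cayley transform *)
  set (al := fun t => tau * A t + - tau * B t + tau).
  set (be := fun t => tau * tau * A t + tau * tau * B t + - (tau * tau)).
  set (ga := fun t => 1 * A t + - (1) * B t + - (1)).
  set (de := fun t => tau * A t + tau * B t + tau).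
  assert (Hnum : forall t z, unit_disc z ->
     al t * z + be t = tau * (A t * cayley tau z + B t - 1) * (tau - z)).
  { intros t z Hz. assert (N := tau_sub_nonzero z Hz). unfold al, be, cayley. field. exact N. }
  assert (Hden : forall t z, unit_disc z ->
     ga t * z + de t = (A t * cayley tau z + B t + 1) * (tau - z)).
  { intros t z Hz. assert (N := tau_sub_nonzero z Hz). unfold ga, de, cayley. field. exact N. }
  exists (fun t => mobius (al t) (be t) (ga t) (de t)). split.
  - apply (mobius_semigroup al be ga de (2 * tau)); try apply CA;
      try (unfold al, be, ga, de; rewrite A0, B0; ring).
    + apply Cmult_neq_0; [|exact N0]. intros E. apply RtoC_inj in E. lra.
    + intros t z Ht Hz. rewrite Hnum, Hden, !Cmod_mult, Htau, Rmult_1_l by assumption.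
      apply Rmult_lt_compat_r; [apply Cmod_gt_0, tau_sub_nonzero, Hz|].
      apply Cmod_sub1_lt_add1. unfold A, B.
      assert (T := cayley_Re_pos z Hz). assert (T2 := exp_pos (p * t)).
      assert (T3 := kp t Ht).
      replace (Re (exp (p * t) * cayley tau z + b * k t))
        with (exp (p * t) * Re (cayley tau z) + Re b * k t)%R
        by (unfold Re; simpl; ring).
      assert (0 < exp (p * t) * Re (cayley tau z))%R by (apply Rmult_lt_0_compat; assumption).
      assert (0 <= Re b * k t)%R by (apply Rmult_le_pos; assumption). lra.
    + intros t s. unfold al, be, ga, de. rewrite AD, BD. repeat split; ring.
  - intros z Hz. unfold mobius. rewrite Hnum, Hden by assumption.
    replace (A 1%R * cayley tau z + B 1%R) with (cayley tau (f z)).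
    2:{ unfold A, B. rewrite Hconj, k1, Rmult_1_r by assumption. ring. }
    assert (N := tau_sub_nonzero z Hz).
    assert (N2 : cayley tau (f z) + 1 <> 0).
    { apply (nonzero_of_Cmod_lt (cayley tau (f z) - 1)), Cmod_sub1_lt_add1.
      apply cayley_Re_pos, Hf, Hz. }
    rewrite <- (cayleyK (f z)) at 3 by (apply Hf, Hz).
    field. split; assumption.
Qed.

(** The translation part has [Re b >= 0], for otherwise points close to [0] would
    leave the half-plane.  The cocycle is [t] for [p = 0] (parabolic) and
    [(exp (p * t) - 1) / (exp p - 1)] otherwise (hyperbolic). *)
Lemma half_plane_hom_embedding (f : C -> C) (p : R) (b : C) :
  (0 <= p)%R -> maps_disc_into_disc f ->
  (forall z, unit_disc z -> cayley tau (f z) = exp p * cayley tau z + b) ->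
  embeddable f.
Proof.
  intros Hp Hf Hconj.
  assert (Hb : (0 <= Re b)%R).
  { apply Rnot_lt_le. intros Hb.
    assert (He := exp_pos p).
    (* a point of the half-plane whose image would have real part [Re b / 2] *)
    set (x := RtoC (- Re b / (2 * exp p))%R).
    assert (Hx : (0 < Re x)%R) by (unfold x; simpl; apply Rdiv_lt_0_compat; lra).
    destruct (cayley_inv_in_disc x Hx) as [H1 H2].
    assert (T := cayley_Re_pos _ (Hf _ H1)). rewrite Hconj, H2 in T by exact H1.
    replace (Re (exp p * x + b)) with (Re b / 2)%R in T; [lra|].
    unfold x, Re. simpl. field. lra. }
  destruct (Req_dec p 0) as [P0 | P0].
  - apply (half_plane_embedding f p b (fun t => t)); auto.
    + apply continuous_id.
    + intros t s. rewrite P0, Rmult_0_l, exp_0. ring.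
  - assert (H1 : (1 < exp p)%R) by (rewrite <- exp_0; apply exp_increasing; lra).
    apply (half_plane_embedding f p b (fun t => ((exp (p * t) - 1) / (exp p - 1))%R)); auto.
    + rewrite Rmult_0_r, exp_0. field. lra.
    + rewrite Rmult_1_r. field. lra.
    + apply (ex_derive_continuous (V := R_NormedModule)). auto_derive. trivial.
    + intros t Ht. apply Rle_div_r; [lra|]. rewrite Rmult_0_l.
      assert (exp 0 <= exp (p * t))%R; [|rewrite exp_0 in *; lra].
      destruct (Req_dec t 0) as [E | N].
      * rewrite E, Rmult_0_r. lra.
      * apply Rlt_le, exp_increasing. nra.
    + intros t s. rewrite Rmult_plus_distr_l, exp_plus. field. lra.
Qed.

End Cayley.

(** * Linear fractional self-maps with a given fixed point *)

Section FixedPoint.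
Variables a b c d tau : C.
Hypothesis Hcd : (Cmod c < Cmod d)%R.
Hypothesis Htau : (Cmod tau <= 1)%R.
Hypothesis Hfix : mobius a b c d tau = tau.

Lemma fixed_point_equation : a * tau + b = tau * (c * tau + d).
Proof.
  assert (N := denominator_nonzero c d tau Hcd Htau).
  transitivity (mobius a b c d tau * (c * tau + d)).
  - unfold mobius. field. exact N.
  - rewrite Hfix. reflexivity.
Qed.

Lemma C_derive_at_fixed_point :
  C_derive (mobius a b c d) tau = (a - tau * c) / (c * tau + d).
Proof.
  assert (N := denominator_nonzero c d tau Hcd Htau).
  rewrite (is_C_derive_unique _ _ _ (is_derive_mobius a b c d tau N)).
  assert (E : b = tau * (c * tau + d) - a * tau) by (rewrite <- fixed_point_equation; ring).
  rewrite E at 1. field. exact N.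
Qed.

Lemma mobius_sub_fixed_point z :
  (Cmod z <= 1)%R ->
  mobius a b c d z - tau = (a - tau * c) * (z - tau) / (c * z + d).
Proof.
  intros Hz. assert (N := denominator_nonzero c d z Hcd Hz).
  assert (E : b = tau * (c * tau + d) - a * tau) by (rewrite <- fixed_point_equation; ring).
  unfold mobius. rewrite E. field. exact N.
Qed.

(** The equation on [c] says that [1 / sigma] is the other fixed point; in this form
    it makes sense for [sigma = 0] as well. *)
Lemma koenigs_mobius (sigma z : C) :
  c = sigma * (a - (c * tau + d)) ->
  (Cmod sigma <= 1)%R -> unit_disc z -> unit_disc (mobius a b c d z) ->
  koenigs tau sigma (mobius a b c d z)
  = C_derive (mobius a b c d) tau * koenigs tau sigma z.
Proof.
  intros Hsigma Hs Hz Hfz. rewrite C_derive_at_fixed_point.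
  assert (N := denominator_nonzero c d tau Hcd Htau).
  assert (Nz := denominator_nonzero c d z Hcd (Rlt_le _ _ Hz)).
  assert (N1 := one_minus_nonzero sigma z Hs Hz).
  change (koenigs tau sigma (mobius a b c d z))
    with ((1 * mobius a b c d z + - tau) / (- sigma * mobius a b c d z + 1)).
  unfold koenigs. unfold mobius at 3.
  replace (1 * mobius a b c d z + - tau)
    with ((a - tau * c) * (z - tau) / (c * z + d))
    by (rewrite <- mobius_sub_fixed_point by (apply Rlt_le, Hz); ring).
  replace (- sigma * mobius a b c d z + 1)
    with ((c * tau + d) * (1 - sigma * z) / (c * z + d)).
  - field. repeat split; first [assumption | nonzero_by_ring N1].
  - assert (E : b = tau * (c * tau + d) - a * tau) by (rewrite <- fixed_point_equation; ring).
    assert (E2 : (c * tau + d) * (1 - sigma * z) = c * z + d - sigma * (a * z + b)).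
    { transitivity (sigma * (a - (c * tau + d)) * (z - tau) + (c * tau + d)
                    - sigma * (a * (z - tau) + tau * (c * tau + d))); [ring|].
      rewrite <- Hsigma, E. ring. }
    rewrite E2. unfold mobius. field. exact Nz.
Qed.

End FixedPoint.

Lemma unit_rotation_to_modulus (kappa : C) : exists u, Cmod u = 1%R /\ kappa * u = RtoC (Cmod kappa).
Proof.
  destruct (Ceq_dec kappa 0) as [E | N].
  - exists 1. rewrite E, Cmod_0. split; [apply Cmod_1 | ring].
  - assert (Hk := proj1 (Cmod_gt_0 _) N).
    assert (NC : RtoC (Cmod kappa) <> 0) by (intros E; apply RtoC_inj in E; lra).
    exists (Cconj kappa / Cmod kappa). split.
    + rewrite Cmod_div, Cmod_conj, Cmod_R, Rabs_right by (try assumption; lra). field. lra.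
    + transitivity (kappa * Cconj kappa / Cmod kappa); [field; exact NC|].
      rewrite <- Cmod2_conj. rewrite RtoC_pow. field. exact NC.
Qed.

(** The bound is the Schwarz lemma for [w |-> m * w / (1 + kappa * w)], obtained by
    testing the point of modulus [1 / (|m| + |kappa|)] at which [kappa * w] is
    negative. *)
Lemma schwarz_mobius (m kappa : C) :
  (forall w, unit_disc w -> (Cmod (m * w) < Cmod (1 + kappa * w))%R) ->
  (Cmod m + Cmod kappa <= 1)%R.
Proof.
  intros H. apply Rnot_lt_le. intros Hlt.
  destruct (unit_rotation_to_modulus kappa) as [u [Hu1 Hu2]].
  set (r := (/ (Cmod m + Cmod kappa))%R).
  assert (Hm := Cmod_ge_0 m). assert (Hk := Cmod_ge_0 kappa).
  assert (Hr : (0 < r)%R) by (apply Rinv_0_lt_compat; lra).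
  assert (Er : (r * (Cmod m + Cmod kappa) = 1)%R) by (unfold r; field; lra).
  assert (Hr1 : (r < 1)%R) by nra.
  assert (EU : Cmod (- (r * u)) = r).
  { rewrite Cmod_opp, Cmod_mult, Hu1, Cmod_R, Rabs_right; lra. }
  specialize (H (- (r * u))).
  assert (T : (Cmod (m * - (r * u)) < Cmod (1 + kappa * - (r * u)))%R)
    by (apply H; unfold unit_disc; lra).
  rewrite Cmod_mult, EU in T.
  replace (1 + kappa * - (r * u)) with (RtoC (1 - r * Cmod kappa)%R) in T.
  - rewrite Cmod_R, Rabs_right in T; nra.
  - rewrite RtoC_minus, RtoC_mult, <- Hu2. ring.
Qed.

(** Schwarz-Pick for the automorphism [(w + tau) / (1 + conj tau * w)]. *)
Lemma disc_translation_lt (tau w : C) :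
  unit_disc tau -> unit_disc w ->
  (Cmod (w + tau) < Cmod (1 + Cconj tau * w))%R.
Proof.
  unfold unit_disc. intros Htau Hw.
  assert (T := disc_quad (Cconj tau) tau w). unfold quad in T.
  replace (Cconj tau - Cconj tau) with (RtoC 0) in T by ring.
  rewrite Cmult_0_l, Cmod_conj in T. simpl Re in T.
  assert (T1 := Cmod_ge_0 w). assert (T2 := Cmod_ge_0 tau).
  assert (Cmod tau ^ 2 < 1)%R by nra. assert (Cmod w ^ 2 < 1)%R by nra.
  assert (T3 := Cmod_ge_0 (w + tau)). assert (T4 := Cmod_ge_0 (1 + Cconj tau * w)).
  nra.
Qed.

Lemma disc_translation_inv_lt (tau z : C) :
  unit_disc tau -> unit_disc z ->
  (Cmod (z - tau) < Cmod (1 - Cconj tau * z))%R.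
Proof.
  intros Htau Hz. assert (T := disc_translation_lt (- tau) z).
  rewrite Copp_conj in T.
  replace (1 - Cconj tau * z) with (1 + - Cconj tau * z) by ring.
  apply T; [unfold unit_disc; rewrite Cmod_opp; exact Htau | exact Hz].
Qed.

Section InnerFixedPoint.
Variables a b c d tau : C.
Hypothesis Hcd : (Cmod c < Cmod d)%R.
Hypothesis Hself : maps_disc_into_disc (mobius a b c d).
Hypothesis Htau : unit_disc tau.
Hypothesis Hfix : mobius a b c d tau = tau.

Let K := c * tau + d.
Let kappa := (c - Cconj tau * (a - K)) / K.

(** Moving [tau] to [0] by a disc automorphism turns the map into
    [w |-> m * w / (1 + kappa * w)], with [m] the derivative at [tau]; [kappa] measures
    how far the second fixed point is from the reflection [1 / conj tau]. *)
Lemma schwarz_pick_fixed_point :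
  (Cmod (C_derive (mobius a b c d) tau) + Cmod kappa <= 1)%R.
Proof.
  assert (Htau' : (Cmod tau <= 1)%R) by (apply Rlt_le, Htau).
  assert (N : K <> 0) by (apply denominator_nonzero; assumption).
  assert (Hct : (Cmod (Cconj tau) <= 1)%R) by (rewrite Cmod_conj; exact Htau').
  rewrite (C_derive_at_fixed_point a b c d tau Hcd Htau' Hfix). fold K.
  apply schwarz_mobius. intros w Hw.
  assert (Him : koenigs_image tau (Cconj tau) w).
  { apply koenigs_image_iff, disc_translation_lt; assumption. }
  set (z := koenigs_inv tau (Cconj tau) w).
  assert (Hz : unit_disc z) by (apply koenigs_inv_in_disc; assumption).
  assert (Nw := koenigs_image_nonzero tau (Cconj tau) w Him).
  assert (Nz := denominator_nonzero c d z Hcd (Rlt_le _ _ Hz)).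
  assert (Hf := Hself z Hz).
  set (f := mobius a b c d z) in *.
  assert (Hlt := disc_translation_inv_lt tau f Htau Hf).
  assert (Ez : z = (w + tau) / (Cconj tau * w + 1)).
  { unfold z, koenigs_inv, mobius. field. exact Nw. }
  assert (E : b = tau * K - a * tau).
  { unfold K. rewrite <- (fixed_point_equation a b c d tau Hcd Htau' Hfix). ring. }
  set (q := K * (1 - Cconj tau * tau) / ((c * z + d) * (Cconj tau * w + 1))).
  assert (Ed : d = K - c * tau) by (unfold K; ring).
  assert (Nz' : c * (w + tau) + d * (Cconj tau * w + 1) <> 0).
  { intros E0. apply Nz. rewrite Ez.
    transitivity ((c * (w + tau) + d * (Cconj tau * w + 1)) / (Cconj tau * w + 1));
      [field; exact Nw|]. rewrite E0. unfold Cdiv. ring. }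
  assert (Eq1 : f - tau = q * ((a - tau * c) / K * w)).
  { unfold f, q. rewrite (mobius_sub_fixed_point a b c d tau Hcd Htau' Hfix z (Rlt_le _ _ Hz)).
    rewrite Ez. field. repeat split; assumption. }
  assert (Eq2 : 1 - Cconj tau * f = q * (1 + kappa * w)).
  { unfold f, q, kappa, mobius. rewrite Ez, E.
    clear - Nz' Nw N Ed. clearbody K. subst d. field. repeat split; assumption. }
  rewrite Eq1, Eq2, !(Cmod_mult q) in Hlt.
  apply Rmult_lt_reg_l with (2 := Hlt).
  assert (T := Cmod_ge_0 q).
  destruct T as [T | T]; [exact T|]. rewrite <- T in Hlt. lra.
Qed.

(** In the coordinate [w] centred at [tau], a second fixed point satisfies
    [m - 1 = kappa * w] with [|w| < 1], against [1 - |m| >= |kappa|]. *)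
Lemma no_second_fixed_point_in_disc (beta : C) :
  (Cmod (C_derive (mobius a b c d) tau) < 1)%R ->
  unit_disc beta -> c * beta = a - K -> False.
Proof.
  intros Hattr Hbeta Ecb.
  assert (Htau' : (Cmod tau <= 1)%R) by (apply Rlt_le, Htau).
  assert (N : K <> 0) by (apply denominator_nonzero; assumption).
  assert (HP := schwarz_pick_fixed_point).
  assert (Hct : (Cmod (Cconj tau) <= 1)%R) by (rewrite Cmod_conj; exact Htau').
  assert (Nb := one_minus_nonzero (Cconj tau) beta Hct Hbeta).
  assert (Ek : kappa = c * (1 - Cconj tau * beta) / K).
  { unfold kappa. rewrite <- Ecb. field. exact N. }
  set (w := (beta - tau) / (1 - Cconj tau * beta)).
  assert (Em : C_derive (mobius a b c d) tau - 1 = kappa * w).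
  { rewrite (C_derive_at_fixed_point a b c d tau Hcd Htau' Hfix), Ek. fold K. unfold w.
    replace a with (c * beta + K) by (rewrite Ecb; ring). field. split; assumption. }
  assert (Hw : (Cmod w < 1)%R).
  { unfold w. rewrite Cmod_div by exact Nb.
    apply Rlt_div_l; [apply Cmod_gt_0, Nb|]. rewrite Rmult_1_l.
    apply disc_translation_inv_lt; assumption. }
  set (m := C_derive (mobius a b c d) tau) in *.
  assert (T := Cmod_sub_ge 1 m). rewrite Cmod_1 in T.
  rewrite <- (Cmod_opp (1 - m)) in T. replace (- (1 - m)) with (m - 1) in T by ring.
  rewrite Em, Cmod_mult in T.
  assert (T2 := Cmod_ge_0 kappa). assert (T3 := Cmod_ge_0 w). nra.
Qed.

(** [|m| = 1] leaves no room for [kappa]: the second fixed point is the reflection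
    of [tau], and the map is a rotation in the disc automorphism coordinate. *)
Lemma neutral_elliptic_embeddable :
  Cmod (C_derive (mobius a b c d) tau) = 1%R -> embeddable (mobius a b c d).
Proof.
  intros Hm.
  assert (Htau' : (Cmod tau <= 1)%R) by (apply Rlt_le, Htau).
  assert (N : K <> 0) by (apply denominator_nonzero; assumption).
  assert (Hct : (Cmod (Cconj tau) <= 1)%R) by (rewrite Cmod_conj; exact Htau').
  assert (HP := schwarz_pick_fixed_point). rewrite Hm in HP.
  assert (Hk : kappa = 0).
  { apply Cmod_eq_0. assert (T := Cmod_ge_0 kappa). lra. }
  assert (Hc : c = Cconj tau * (a - K)).
  { transitivity (kappa * K + Cconj tau * (a - K)); [unfold kappa; field; exact N|].
    rewrite Hk. ring. }
  destruct (Cexp_surj_circle _ Hm) as [mu [Hmu0 Hmu1]].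
  apply (elliptic_embedding tau (Cconj tau) Htau Hct _ mu).
  - lra.
  - replace (Cconj tau - Cconj tau) with (RtoC 0) by ring. rewrite Cmod_0, Hmu0. lra.
  - exact Hself.
  - intros z Hz. rewrite Hmu1. apply koenigs_mobius; auto.
Qed.

End InnerFixedPoint.

(** In the Cayley coordinate the map is [x |-> x / r + b], with dilation factor the
    inverse of the derivative at [tau]. *)
Lemma boundary_fixed_point_embeddable (a b c d tau : C) (r : R) :
  (Cmod c < Cmod d)%R -> maps_disc_into_disc (mobius a b c d) ->
  Cmod tau = 1%R -> mobius a b c d tau = tau ->
  (0 < r <= 1)%R -> C_derive (mobius a b c d) tau = RtoC r ->
  embeddable (mobius a b c d).
Proof.
  intros Hcd Hself Htau Hfix Hr Hder.
  assert (Htau' : (Cmod tau <= 1)%R) by lra.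
  assert (N := denominator_nonzero c d tau Hcd Htau').
  assert (N0 := unit_circle_nonzero tau Htau).
  rewrite (C_derive_at_fixed_point a b c d tau Hcd Htau' Hfix) in Hder.
  set (K := c * tau + d) in *.
  assert (Nr : RtoC r <> 0) by (intros E; apply RtoC_inj in E; lra).
  assert (Ea : a - tau * c = r * K) by (rewrite <- Hder; field; exact N).
  apply (half_plane_hom_embedding tau Htau _ (- ln r)
           (/ r - 1 - 2 * tau * c / (r * K))).
  - assert (ln r <= ln 1)%R; [|rewrite ln_1 in *; lra].
    destruct (Req_dec r 1) as [E | E]; [rewrite E; lra|]. apply Rlt_le, ln_increasing; lra.
  - exact Hself.
  - intros z Hz.
    assert (Nz := tau_sub_nonzero tau Htau z Hz).
    assert (Nf := tau_sub_nonzero tau Htau _ (Hself z Hz)).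
    assert (Nd := denominator_nonzero c d z Hcd (Rlt_le _ _ Hz)).
    rewrite exp_Ropp, exp_ln, RtoC_inv by lra.
    assert (Ef : tau - mobius a b c d z = r * K * (tau - z) / (c * z + d)).
    { transitivity (- (mobius a b c d z - tau)); [ring|].
      rewrite (mobius_sub_fixed_point a b c d tau Hcd Htau' Hfix z (Rlt_le _ _ Hz)), Ea.
      field. exact Nd. }
    unfold cayley.
    transitivity (2 * tau / (tau - mobius a b c d z) - 1); [field; exact Nf|].
    rewrite Ef.
    replace (c * z + d) with (K - c * (tau - z)) in * by (unfold K; ring).
    clearbody K. field. repeat split; assumption.
Qed.

(** A repulsive fixed point in the disc is excluded, so its reciprocal has modulus
    at most [1]; dividing the difference of the two fixed point equations by
    [beta - tau] gives the equation on [c]. *)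
Lemma repulsive_fixed_point_reciprocal (a b c d tau : C) (beta : sphere) :
  (Cmod c < Cmod d)%R -> maps_disc_into_disc (mobius a b c d) ->
  attractive_elliptic_with_DW_point (mobius a b c d) tau ->
  repulsive_fixed_point a b c d tau beta ->
  (Cmod (sphere_inv beta) <= 1)%R /\
  c = sphere_inv beta * (a - (c * tau + d)).
Proof.
  intros Hcd Hself [Htau [Hfix Hattr]] [Hb Hne].
  assert (Htau' : (Cmod tau <= 1)%R) by (apply Rlt_le, Htau).
  destruct beta as [beta|]; simpl in *.
  - destruct (Ceq_dec (c * beta + d) 0) as [E | N]; [discriminate|].
    injection Hb as Hb.
    assert (Eb : a * beta + b = beta * (c * beta + d)).
    { transitivity (mobius a b c d beta * (c * beta + d)).
      - unfold mobius. field. exact N.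
      - rewrite Hb. reflexivity. }
    assert (Et := fixed_point_equation a b c d tau Hcd Htau' Hfix).
    assert (Nbt : beta - tau <> 0).
    { intros E. apply Hne. f_equal. transitivity (beta - tau + tau); [ring|].
      rewrite E. ring. }
    assert (Ecb : c * beta = a - (c * tau + d)).
    { transitivity ((beta * (c * beta + d) - tau * (c * tau + d)) / (beta - tau) - c * tau - d).
      - field. exact Nbt.
      - rewrite <- Eb, <- Et. field. exact Nbt. }
    assert (H1 : (1 <= Cmod beta)%R).
    { apply Rnot_lt_le. intros Hbeta.
      exact (no_second_fixed_point_in_disc a b c d tau Hcd Hself Htau Hfix beta Hattr Hbeta Ecb). }
    assert (Nb : beta <> 0) by (apply Cmod_gt_0; lra).
    split.
    + rewrite Cmod_inv by exact Nb. rewrite <- Rinv_1. apply Rinv_le_contravar; lra.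
    + rewrite <- Ecb. field. exact Nb.
  - destruct (Ceq_dec c 0) as [E | N]; [|discriminate].
    rewrite Cmod_0, E. split; [lra | ring].
Qed.

(** Inserting the length and cancelling [|exp lambda|] leaves
    [|conj tau - sigma| * |lambda| <= - Re lambda * |1 - tau * sigma|], which is squared and
    simplified with
    [|1 - tau * sigma|^2 = |conj tau - sigma|^2 + (1 - |sigma|^2) * (1 - |tau|^2)]. *)
Lemma spiral_condition_iff (tau sigma lambda : C) :
  (Cmod tau < 1)%R -> (Cmod sigma <= 1)%R -> (Re lambda < 0)%R ->
  ((Cmod (Cconj tau - sigma) * length_from_1 (canonical_spiral lambda)
      <= Cmod (Cexp lambda) * Cmod (1 - tau * sigma))%R <->
   (Cmod (Cconj tau - sigma) ^ 2 * Im lambda ^ 2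
     <= Re lambda ^ 2 * ((1 - Cmod sigma ^ 2) * (1 - Cmod tau ^ 2)))%R).
Proof.
  intros Ht Hs Hl. rewrite length_canonical_spiral by exact Hl.
  assert (HE : (Cmod (1 - tau * sigma) ^ 2 = Cmod (Cconj tau - sigma) ^ 2
                 + (1 - Cmod sigma ^ 2) * (1 - Cmod tau ^ 2))%R).
  { rewrite !Cmod_sqr. destruct tau, sigma. simpl. ring. }
  assert (HL := Cmod2_alt lambda).
  assert (He : (0 < Cmod (Cexp lambda))%R) by (rewrite Cmod_Cexp; apply exp_pos).
  assert (P1 := Cmod_ge_0 (Cconj tau - sigma)). assert (P2 := Cmod_ge_0 (1 - tau * sigma)).
  assert (P3 := Cmod_ge_0 lambda).
  set (B := Cmod (Cconj tau - sigma)) in *. set (D := Cmod (1 - tau * sigma)) in *.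
  set (L := Cmod lambda) in *. set (E := Cmod (Cexp lambda)) in *.
  set (Q := ((1 - Cmod sigma ^ 2) * (1 - Cmod tau ^ 2))%R) in *.
  set (p := Re lambda) in *. set (th := Im lambda) in *.
  assert (X : (B * (L * E / - p) <= E * D)%R <-> (B * L <= - p * D)%R).
  { replace (B * (L * E / - p))%R with (E * (B * L / - p))%R by (field; lra). split; intros H.
    - apply Rmult_le_reg_l in H; [|exact He]. apply Rle_div_l in H; lra.
    - apply Rmult_le_compat_l; [lra|]. apply Rle_div_l; lra. }
  rewrite X.
  assert (Hsq : ((- p * D) ^ 2 - (B * L) ^ 2 = p ^ 2 * Q - B ^ 2 * th ^ 2)%R).
  { transitivity (p ^ 2 * D ^ 2 - B ^ 2 * L ^ 2)%R; [ring|]. rewrite HE, HL. ring. }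
  assert (N1 : (0 <= B * L)%R) by (apply Rmult_le_pos; assumption).
  assert (N2 : (0 <= - p * D)%R) by (apply Rmult_le_pos; lra).
  split; intros H.
  - assert ((B * L) ^ 2 <= (- p * D) ^ 2)%R by (apply pow_incr; lra). lra.
  - apply Rnot_lt_le. intros H'. nra.
Qed.

Theorem proposition3p4 :
  forall a b c d : C,
  linear_fractional_self_map a b c d ->
  let phi := mobius a b c d in
  (trivial_map phi \/ neutral_elliptic phi \/ hyperbolic phi \/ parabolic phi ->
   embeddable phi) /\
  (forall (tau : C) (beta : sphere) (lambda : C),
   attractive_elliptic_with_DW_point phi tau ->
   repulsive_fixed_point a b c d tau beta ->
   canonical_exponent (C_derive phi tau) lambda ->
   let ell := length_from_1 (canonical_spiral lambda) in
   embeddable phi <->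
   (Cmod (Cconj tau - sphere_inv beta) * ell
      <= Cmod (C_derive phi tau) * Cmod (1 - tau * sphere_inv beta))%R).
Proof.
  intros a b c d [Hcd [_ Hself]] phi. split.
  - intros [Htriv | [[_ [tau [Htau [Hfix Hm]]]] |
      [[_ [_ [tau [Htau [Hfix [r [Hr Hder]]]]]]] | [_ [_ [tau [Htau [Hfix Hder]]]]]]]].
    + (* the identity is the multiplication by [exp 0] in the coordinate [w = z] *)
      apply (elliptic_embedding (RtoC 0) (RtoC 0)) with (mu := RtoC 0);
        rewrite ?Cmod_0; simpl; try lra.
      * exact Hself.
      * intros z Hz. unfold phi in *. rewrite Htriv, Cexp_0 by exact Hz. ring.
    + apply (neutral_elliptic_embeddable a b c d tau); assumption.
    + apply (boundary_fixed_point_embeddable a b c d tau r); try assumption. lra.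
    + apply (boundary_fixed_point_embeddable a b c d tau 1); try assumption. lra.
  - intros tau beta lambda Hattr Hrep [Hl1 [Hl2 Hl3]] ell.
    destruct (repulsive_fixed_point_reciprocal a b c d tau beta Hcd Hself Hattr Hrep)
      as [Hsigma Hc].
    destruct Hattr as [Htau [Hfix Hm]].
    set (sigma := sphere_inv beta) in *.
    assert (Htau' : (Cmod tau <= 1)%R) by (apply Rlt_le, Htau).
    assert (Hconj : forall z, unit_disc z ->
              koenigs tau sigma (phi z) = Cexp lambda * koenigs tau sigma z).
    { intros z Hz. rewrite Hl3. apply koenigs_mobius; auto. }
    rewrite <- Hl3. unfold ell. rewrite spiral_condition_iff by assumption.
    split.
    + intros Hemb.
      destruct (embeddable_spiral tau sigma Htau Hsigma phi (Cexp lambda))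
        as [mu [Emu Hmu]]; try assumption.
      { apply Cmod_gt_0. rewrite Cmod_Cexp. apply exp_pos. }
      { rewrite Hl3. exact Hm. }
      destruct (Cexp_eq mu lambda Emu) as [ER EI].
      { apply Rabs_le. lra. }
      assert (T := Cmod_ge_0 sigma). assert (T2 := Cmod_ge_0 tau).
      assert (Hnec := spiral_condition_necessary (1 - Cmod sigma ^ 2) (Cconj tau - sigma)
                        (1 - Cmod tau ^ 2) mu).
      unfold unit_disc in Htau. rewrite ER in Hnec.
      apply Rle_trans with (2 := Hnec ltac:(nra) ltac:(nra) Hl1 Hmu).
      apply Rmult_le_compat_l; [apply pow2_ge_0|].
      rewrite <- (pow2_abs (Im lambda)), <- (pow2_abs (Im mu)).
      apply pow_incr. split; [apply Rabs_pos | exact EI].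
    + intros Hcond. apply (elliptic_embedding tau sigma Htau Hsigma phi lambda); auto. lra.
Qed.
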